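(* Let $m\in\{2,3\}$ and consider the second-order system $$\dot p = v,\qquad \dot v = u,$$ with the mismatched control input $$u = -v-\overline B D_z e-\overline S_1 D_z\mu,$$ where the desired shape for the formation is infinitesimally and minimally rigid. There exist sufficiently small $\epsilon_1,\epsilon_2\in\mathbb R^+$ such that if the mismatches satisfy $\|\mu\|\le\epsilon_1$, then the error signal $e(t)\to e^*\in\mathbb R^{|\mathcal E|}$ as $t\to\infty$ with $\|e^*\|\le\epsilon_2$ such that the steady-state shape of the formation is still infinitesimally and minimally rigid but distorted with respect to the desired one. Moreover, the velocities of the agents satisfy $v_i(t)\to v_i^*(t)$ as $t\to\infty$, where all the $v_i^*(t)$, $i\in\{1,\dots,n\}$, define a steady-state collective motion that can be captured by constant angular and translational velocities ${}^b\omega^*$ and ${}^bv_c^*$, respectively, where the body frame $O_b$ has been placed at the centroid of the resultant distorted infinitesimally and minimally rigid shape.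
   Context: Notation. $n\ge2$ agents have positions $p_i\in\mathbb R^m$ and velocities $v_i\in\mathbb R^m$; $p,v,u\in\mathbb R^{mn}$ are the stacked positions, velocities and control inputs. For a matrix $A$, $\overline A=A\otimes I_m$ (Kronecker product). For a stacked vector $x=[x_1^T\dots x_k^T]^T$ with blocks $x_i\in\mathbb R^m$, $D_x=\operatorname{diag}\{x_i\}$ is the $km\times k$ block-diagonal matrix with the column blocks $x_i$. $\|\cdot\|$ is the Euclidean norm. Graph. The sensing topology is an undirected graph $\mathbb G=(\mathcal V,\mathcal E)$, $\mathcal V=\{1,\dots,n\}$, whose edges are ordered and written $\mathcal E_k=(\mathcal E_k^{\rm tail},\mathcal E_k^{\rm head})$. The incidence matrix $B\in\mathbb R^{|\mathcal V|\times|\mathcal E|}$ has entries $b_{ik}=1$ if $i=\mathcal E_k^{\rm tail}$, $b_{ik}=-1$ if $i=\mathcal E_k^{\rm head}$, and $0$ otherwise. $S_1$ is obtained from $B$ by setting its $-1$ entries to $0$. The vector $z=\overline B^Tp$ stacks the relative positions $z_k=p_i-p_j$ for $\mathcal E_k=(i,j)$. Rigidity. The rigidity matrix is $R(z)=D_z^T\overline B^T$. A framework $(\mathbb G,p)$ is infinitesimally rigid if $\operatorname{rank}R(z)=2n-3$ (for $m=2$) or $3n-6$ (for $m=3$); it is infinitesimally and minimally rigid if in addition $|\mathcal E|=2n-3$ or $|\mathcal E|=3n-6$, respectively. Given a stacked vector of desired relative positions $z^*$, the desired shape is $\mathcal Z=\{(I_{|\mathcal E|}\otimes \mathcal R)z^*\}$,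 where $\mathcal R$ ranges over all rotation matrices in $\mathbb R^m$, and $d_k=\|z_k^*\|$ are the desired inter-agent distances. The error signal $e\in\mathbb R^{|\mathcal E|}$ is the stacked vector of $e_k=\|z_k\|^2-d_k^2$. Mismatches. $\mu\in\mathbb R^{|\mathcal E|}$ is the stacked vector of constant mismatches $\mu_k\in\mathbb R$; $\mu_k$ is the discrepancy between the squared desired distances used by the two agents of edge $\mathcal E_k$: the head agent uses $d_k^2$ and the tail agent uses $d_k^2-\mu_k$. Frames. $O_g$ is a fixed global frame, in which $p$, $v$ and $z$ are expressed; $O_b$ is a body frame attached to the (distorted) rigid formation, with origin at its centroid and rotating with it. A left superscript $b$ indicates that a quantity is expressed in $O_b$. That the collective motion is captured by ${}^b\omega^*$ and ${}^bv_c^*$ means that the $v_i^*(t)$ are the velocities of the agents when the distorted shape moves as a rigid body with angular velocity ${}^b\omega^*$ and with translational velocity ${}^bv_c^*$ of its centroid, both constant in $O_b$.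
   Formalization: The claim is proved for initial conditions whose relative positions are close to the desired shape and whose velocities are small; without this it fails, since p = v = 0 is an equilibrium with e = -d² for every mismatch. *)

(* Defs.v *)
From mathcomp Require Import all_boot all_order all_algebra.
From mathcomp.real_closed Require Import mxtens.
From mathcomp Require Import all_classical all_reals all_analysis.
Set Implicit Arguments.
Unset Strict Implicit.
Unset Printing Implicit Defensive.
Import Order.TTheory GRing.Theory Num.Theory.
Import numFieldNormedType.Exports.
Local Open Scope classical_set_scope.
Local Open Scope ring_scope.

(* A simple undirected graph on 'I_n whose q edges are enumerated, each edge
   being given an arbitrary orientation. *)
Record sensing_graph (n q : nat) := SensingGraph {
  etail : 'I_q -> 'I_n;
  ehead : 'I_q -> 'I_n;
  edge_irrefl : forall k, etail k != ehead k;
  edge_inj : injective (fun k => [set etail k; ehead k]%SET) }.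

Section Formation.
Variable R : realType.

(* The library norm on matrices is the sup norm, hence this definition. *)
Definition enorm (k : nat) (x : 'cV[R]_k) : R :=
  Num.sqrt (\sum_i x i 0 ^+ 2).

(* A stacked vector of k blocks in R^m is a column of height k * m, indexed by
   pairs (block, coordinate) in the same way as the Kronecker product. *)
Definition blk (k m : nat) (x : 'cV[R]_(k * m)) (i : 'I_k) : 'cV[R]_m :=
  \col_a x (mxtens_index (i, a)) 0.

Definition bar (m k l : nat) (A : 'M[R]_(k, l)) : 'M[R]_(k * m, l * m) :=
  tensmx A (1%:M : 'M[R]_m).

Definition blkdiag (k m : nat) (x : 'cV[R]_(k * m)) : 'M[R]_(k * m, k) :=
  \matrix_(r, j) (if (mxtens_unindex r).1 == j then x r 0 else 0).

Definition rotation (m : nat) : set 'M[R]_m :=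
  [set Q | Q^T *m Q = 1%:M /\ \det Q = 1].

Section Graph.
Variables (n m q : nat) (G : sensing_graph n q).

Definition incidence : 'M[R]_(n, q) :=
  \matrix_(i, k) (if i == etail G k then 1
                  else if i == ehead G k then -1 else 0).

Definition incidence_tail : 'M[R]_(n, q) :=
  \matrix_(i, k) (if incidence i k == -1 then 0 else incidence i k).

Definition relpos (p : 'cV[R]_(n * m)) : 'cV[R]_(q * m) :=
  (bar m incidence)^T *m p.

Definition rigidity_mx (z : 'cV[R]_(q * m)) : 'M[R]_(q, n * m) :=
  (blkdiag z)^T *m (bar m incidence)^T.

Definition rigid_rank : nat := if m == 2%N then (2 * n - 3)%N else (3 * n - 6)%N.

Definition inf_rigid (p : 'cV[R]_(n * m)) : Prop :=
  \rank (rigidity_mx (relpos p)) = rigid_rank.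

Definition inf_min_rigid (p : 'cV[R]_(n * m)) : Prop :=
  inf_rigid p /\ q = rigid_rank.

Definition desired_shape (zd : 'cV[R]_(q * m)) : set 'cV[R]_(q * m) :=
  [set tensmx (1%:M : 'M[R]_q) Q *m zd | Q in @rotation m].

Definition error (zd z : 'cV[R]_(q * m)) : 'cV[R]_q :=
  \col_k (enorm (blk z k) ^+ 2 - enorm (blk zd k) ^+ 2).

Definition control (zd : 'cV[R]_(q * m)) (mu : 'cV[R]_q)
    (p v : 'cV[R]_(n * m)) : 'cV[R]_(n * m) :=
  let z := relpos p in
  - v - bar m incidence *m blkdiag z *m error zd z
      - bar m incidence_tail *m blkdiag z *m mu.

(* Solutions on [0, +oo[; only the right limit is relevant at time 0. *)
Definition solution (zd : 'cV[R]_(q * m)) (mu : 'cV[R]_q)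
    (p v : R -> 'cV[R]_(n * m)) : Prop :=
  [/\ {within `[0, +oo[, continuous p},
      {within `[0, +oo[, continuous v},
      (forall t : R, 0 < t -> is_derive t 1 p (v t)) &
      (forall t : R, 0 < t -> is_derive t 1 v (control zd mu (p t) (v t)))].

End Graph.

(* Matrix of the map x |-> w \times x. For m = 2 this is its restriction to the
   plane of the motion: only the component w_2 normal to the plane acts. *)
Definition cross_mx (m : nat) (w : 'cV[R]_3) : 'M[R]_m :=
  \matrix_(i < m, j < m)
    match nat_of_ord i, nat_of_ord j with
    | 0%N, 1%N => - w (inord 2) 0
    | 1%N, 0%N => w (inord 2) 0
    | 0%N, 2%N => w (inord 1) 0
    | 2%N, 0%N => - w (inord 1) 0
    | 1%N, 2%N => - w (inord 0) 0
    | 2%N, 1%N => w (inord 0) 0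
    | _, _ => 0
    end.

Definition centered (n m : nat) (r : 'cV[R]_(n * m)) : Prop :=
  \sum_i blk r i = 0.

(* ps and vs are the positions and velocities, in the global frame, of points
   that move as a rigid body: r stacks their constant coordinates in the body
   frame, Q t is the attitude of the body frame (it maps body coordinates to
   global ones), c t is its origin, and w, vc are the angular velocity and the
   velocity of the origin, both constant in the body frame. *)
Definition rigid_body_motion (n m : nat) (r : 'cV[R]_(n * m))
    (w : 'cV[R]_3) (vc : 'cV[R]_m) (ps vs : R -> 'cV[R]_(n * m)) : Prop :=
  exists (Q : R -> 'M[R]_m) (c : R -> 'cV[R]_m), forall t : R,
    [/\ rotation (Q t),
        is_derive t 1 Q (Q t *m cross_mx m w),
        is_derive t 1 c (Q t *m vc),
        (forall i, blk (ps t) i = c t + Q t *m blk r i) &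
        is_derive t 1 ps (vs t)].

End Formation.

(* Main.v *)
From HB Require Import structures.
Require Import Defs.
From mathcomp Require Import all_boot all_order all_algebra.
From mathcomp.real_closed Require Import mxtens.
From mathcomp Require Import all_classical all_reals all_analysis.
From mathcomp Require Import ring lra zify perm.
Import Order.TTheory GRing.Theory Num.Theory.
Import numFieldNormedType.Exports.
Set Implicit Arguments.
Unset Strict Implicit.
Unset Printing Implicit Defensive.
Local Open Scope classical_set_scope.
Local Open Scope ring_scope.

(** A configuration is encoded by the matrix P whose rows are the positions of
    the agents, so that the relative positions are Z = B^T P, and the errors are
    the row-wise squared norms of Z minus the desired ones.  The equations of
    motion become P' = V and V' = - V - B diag(e) Z - S diag(mu) Z: apart from
    the dependence of e on Z they are linear, and matrices n x q act on Z from
    the left, hence commute with rotations.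

    Steady motions.  Suppose a matrix C solves
    C + C B^T C + B diag(e) + S diag(mu) = 0 with e the error of a configuration
    Zs, and that moving Zs with the velocities C Zs changes no edge length to
    first order.  Then, for rigid Zs, P' = C Z is a solution along which Z stays a
    rotated copy of Zs.  Such a pair exists near C = 0 and the desired shape (lemma
    relative_equilibrium, by Banach's theorem): the linear part of the equations
    is invertible because the rows of the rigidity matrix are independent.  By
    infinitesimal rigidity (ker_rigidity) the field C Zs is the velocity field
    of a rigid body, which gives the two constant body velocities.

    Convergence of the shape.  With Y = V - C Z and E the error relative to Zs
    the mismatches cancel exactly (acceleration_shift): Y' = - Y - B diag(E) Z -
    C B^T Y, and E' is twice the rigidity matrix applied to Y, plus a term that
    is quadratic in Z, invariant under rotations and zero at Zs.  Local rigidity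
    (alignment) bounds this term by a small multiple of E.  So the energy
    |E|^2 / 2 + |Y|^2, corrected by a small multiple of the inner product of
    B diag(E) Z and Y, decays exponentially; conversely, its smallness and local
    rigidity keep the shape near the desired one for all times (error_decay).

    Convergence of the motion.  At each time some rotation of Zs is
    exponentially close to Z.  Following the steady motion backwards from a late
    time multiplies distances by an exponential of small rate, as C is small;
    so the steady motions matched to Z at later and later times approximate Z
    well on the whole half-line, and by compactness of the group of rotations
    they accumulate at one that is asymptotic to Z (asymptotic_phase).  Steady
    motions are explicit, by Rodrigues' formula. *)

(** * Frobenius geometry of configurations *)

Section Frobenius.
Variable R : realType.

Definition fdot (a b : nat) (X Y : 'M[R]_(a, b)) : R := \tr (X *m Y^T).
Definition fnorm (a b : nat) (X : 'M[R]_(a, b)) : R := Num.sqrt (fdot X X).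
Definition rscale (k m : nat) (e : 'cV[R]_k) (Z : 'M[R]_(k, m)) : 'M[R]_(k, m) :=
  diag_mx e^T *m Z.
Definition rdot (k m : nat) (X Y : 'M[R]_(k, m)) : 'cV[R]_k :=
  \col_i \sum_j X i j * Y i j.

Section fdot.
Variables a b : nat.
Implicit Types X Y Z : 'M[R]_(a, b).

Lemma fdotE X Y : fdot X Y = \sum_i \sum_j X i j * Y i j.
Proof.
by apply: eq_bigr => i _; rewrite mxE; apply: eq_bigr => j _; rewrite mxE.
Qed.

Lemma fdotC X Y : fdot X Y = fdot Y X.
Proof.
by rewrite !fdotE; apply: eq_bigr => i _; apply: eq_bigr => j _; rewrite mulrC.
Qed.

Lemma fdotDl X Y Z : fdot (X + Y) Z = fdot X Z + fdot Y Z.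
Proof. by rewrite /fdot mulmxDl raddfD. Qed.
Lemma fdotDr X Y Z : fdot Z (X + Y) = fdot Z X + fdot Z Y.
Proof. by rewrite !(fdotC Z) fdotDl. Qed.
Lemma fdotNl X Y : fdot (- X) Y = - fdot X Y.
Proof. by rewrite /fdot mulNmx raddfN. Qed.
Lemma fdotNr X Y : fdot X (- Y) = - fdot X Y.
Proof. by rewrite !(fdotC X) fdotNl. Qed.
Lemma fdotBl X Y Z : fdot (X - Y) Z = fdot X Z - fdot Y Z.
Proof. by rewrite fdotDl fdotNl. Qed.
Lemma fdotBr X Y Z : fdot Z (X - Y) = fdot Z X - fdot Z Y.
Proof. by rewrite fdotDr fdotNr. Qed.
Lemma fdotZl c X Y : fdot (c *: X) Y = c * fdot X Y.
Proof. by rewrite /fdot -scalemxAl mxtraceZ. Qed.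
Lemma fdotZr c X Y : fdot X (c *: Y) = c * fdot X Y.
Proof. by rewrite !(fdotC X) fdotZl. Qed.
Lemma fdot0l X : fdot 0 X = 0.
Proof. by rewrite /fdot mul0mx raddf0. Qed.
Lemma fdot0r X : fdot X 0 = 0.
Proof. by rewrite fdotC fdot0l. Qed.

Lemma fdot_ge0 X : 0 <= fdot X X.
Proof.
by rewrite fdotE; do 2![apply: sumr_ge0 => ? _]; rewrite -expr2 sqr_ge0.
Qed.

Lemma fdot_eq0 X : fdot X X = 0 -> X = 0.
Proof.
rewrite fdotE => /eqP; rewrite psumr_eq0; last first.
  by move=> i _; apply: sumr_ge0 => j _; rewrite -expr2 sqr_ge0.
move=> /allP X0; apply/matrixP => i j; rewrite mxE.
have /X0/= : i \in index_enum _ by rewrite mem_index_enum.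
rewrite psumr_eq0; last by move=> k _; rewrite -expr2 sqr_ge0.
move=> /allP/(_ j); rewrite mem_index_enum => /(_ isT)/=.
by rewrite mulf_eq0 orbb => /eqP.
Qed.

Lemma fnorm_ge0 X : 0 <= fnorm X.
Proof. exact: sqrtr_ge0. Qed.

Lemma fnormsq X : fnorm X ^+ 2 = fdot X X.
Proof. by rewrite sqr_sqrtr ?fdot_ge0. Qed.

Lemma fdot_CS X Y : `|fdot X Y| <= fnorm X * fnorm Y.
Proof.
rewrite -(@ler_pXn2r _ 2) ?nnegrE ?mulr_ge0 ?fnorm_ge0//.
rewrite exprMn !fnormsq real_normK ?num_real//.
have := fdot_ge0 (fdot Y Y *: X - fdot X Y *: Y).
rewrite !(fdotBl, fdotBr, fdotZl, fdotZr) (fdotC Y X).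
set x := fdot X X; set y := fdot Y Y; set c := fdot X Y => H.
have : 0 <= y * (x * y - c ^+ 2) by lra.
have [y0|] := eqVneq y 0.
  by move=> _; rewrite /c (fdot_eq0 y0) fdot0r expr0n/= mulr_ge0// fdot_ge0.
by move=> yN0; rewrite pmulr_rge0 ?subr_ge0// lt_neqAle eq_sym yN0 fdot_ge0.
Qed.

Lemma fdot_le X Y : fdot X Y <= fnorm X * fnorm Y.
Proof. by rewrite (le_trans (ler_norm _))// fdot_CS. Qed.

Lemma fnorm0 : fnorm (0 : 'M[R]_(a, b)) = 0.
Proof. by rewrite /fnorm fdot0l sqrtr0. Qed.

Lemma fnorm_eq0 X : fnorm X = 0 -> X = 0.
Proof. by move=> X0; apply: fdot_eq0; rewrite -fnormsq X0 expr0n. Qed.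

Lemma fnormN X : fnorm (- X) = fnorm X.
Proof. by rewrite /fnorm fdotNl fdotNr opprK. Qed.

Lemma fnormD X Y : fnorm (X + Y) <= fnorm X + fnorm Y.
Proof.
rewrite -(@ler_pXn2r _ 2) ?nnegrE ?addr_ge0 ?fnorm_ge0//.
rewrite sqrrD !fnormsq fdotDl !fdotDr (fdotC Y X).
by have := fdot_le X Y; lra.
Qed.

Lemma fnormB X Y : fnorm (X - Y) <= fnorm X + fnorm Y.
Proof. by rewrite -(fnormN Y) fnormD. Qed.

Lemma fnormBC X Y : fnorm (X - Y) = fnorm (Y - X).
Proof. by rewrite -fnormN opprB. Qed.

Lemma fnorm_dist X Y : `|fnorm X - fnorm Y| <= fnorm (X - Y).
Proof.
have := fnormD (X - Y) Y; have := fnormD (Y - X) X.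
by rewrite !subrK (fnormBC Y) ler_norml; lra.
Qed.

Lemma fnormZ c X : fnorm (c *: X) = `|c| * fnorm X.
Proof.
by rewrite /fnorm fdotZl fdotZr mulrA sqrtrM -?expr2 ?sqr_ge0// sqrtr_sqr.
Qed.

Lemma fnorm_ge_coord X i j : `|X i j| <= fnorm X.
Proof.
rewrite -(@ler_pXn2r _ 2) ?nnegrE ?fnorm_ge0// fnormsq real_normK ?num_real//.
rewrite fdotE (bigD1 i)//= (bigD1 j)//= -expr2 -addrA lerDl.
by rewrite addr_ge0//; do ?[apply: sumr_ge0 => ? _]; rewrite -expr2 sqr_ge0.
Qed.

Lemma normr_le_fnorm X : `|X| <= fnorm X.
Proof.
rewrite [leLHS]/Num.Def.normr/= mx_normrE.
by apply/bigmax_leP; split=> [|? _]; rewrite ?fnorm_ge0 ?fnorm_ge_coord.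
Qed.

Lemma coord_le_normr X i j : `|X i j| <= `|X|.
Proof.
rewrite [leRHS]/Num.Def.normr/= mx_normrE.
exact: (le_bigmax _ (fun ij : 'I_a * 'I_b => `|X ij.1 ij.2|) (i, j)).
Qed.

Lemma fnorm_le_normr X : fnorm X <= Num.sqrt (a * b)%:R * `|X|.
Proof.
rewrite -(@ler_pXn2r _ 2) ?nnegrE ?mulr_ge0 ?fnorm_ge0 ?sqrtr_ge0//.
rewrite fnormsq exprMn sqr_sqrtr// fdotE.
apply: (@le_trans _ _ (\sum_(i < a) \sum_(j < b) `|X| ^+ 2)).
  do 2![apply: ler_sum => ? _]; rewrite -expr2 -[leLHS]ger0_norm ?sqr_ge0//.
  by rewrite normrX lerXn2r ?nnegrE// coord_le_normr.
by rewrite !sumr_const !card_ord -mulrnA mulnC mulr_natl.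
Qed.

End fdot.

Lemma fdot_mull a b c (A : 'M[R]_(a, b)) (X : 'M[R]_(b, c)) Y :
  fdot (A *m X) Y = fdot X (A^T *m Y).
Proof. by rewrite /fdot trmx_mul trmxK -mulmxA mxtrace_mulC mulmxA. Qed.

Lemma fdot_mulr a b c (A : 'M[R]_(b, c)) (X : 'M[R]_(a, b)) Y :
  fdot (X *m A) Y = fdot X (Y *m A^T).
Proof. by rewrite /fdot trmx_mul trmxK mulmxA. Qed.

Lemma fnorm_tr a b (X : 'M[R]_(a, b)) : fnorm X^T = fnorm X.
Proof. by rewrite /fnorm /fdot trmxK mxtrace_mulC. Qed.

Lemma fnorm_mul a b c (A : 'M[R]_(a, b)) (X : 'M[R]_(b, c)) :
  fnorm (A *m X) <= fnorm A * fnorm X.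
Proof.
rewrite -(@ler_pXn2r _ 2) ?nnegrE ?mulr_ge0 ?fnorm_ge0// exprMn !fnormsq.
rewrite fdotE [fdot A A]fdotE mulr_suml; apply: ler_sum => i _.
have -> : fdot X X = \sum_j \sum_k X k j * X k j.
  by rewrite fdotE exchange_big.
rewrite mulr_sumr; apply: ler_sum => j _.
have : `|fdot (row i A) (row j X^T)| ^+ 2 <=
       (fnorm (row i A) * fnorm (row j X^T)) ^+ 2.
  by rewrite ler_pXn2r ?nnegrE ?mulr_ge0 ?fnorm_ge0// fdot_CS.
rewrite exprMn !fnormsq real_normK ?num_real// !fdotE !big_ord1 -expr2.
have -> : \sum_l row i A ord0 l * row j X^T ord0 l = (A *m X) i j.
  by rewrite mxE; apply: eq_bigr => l _; rewrite !mxE.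
have -> : \sum_l row i A ord0 l * row i A ord0 l = \sum_l A i l * A i l.
  by apply: eq_bigr => l _; rewrite !mxE.
have -> // : \sum_l row j X^T ord0 l * row j X^T ord0 l =
             \sum_l X l j * X l j.
by apply: eq_bigr => l _; rewrite !mxE.
Qed.

Lemma fnorm_orth a b (X : 'M[R]_(a, b)) (Q : 'M[R]_b) :
  Q *m Q^T = 1%:M -> fnorm (X *m Q) = fnorm X.
Proof. by move=> Q1; rewrite /fnorm fdot_mulr -mulmxA Q1 mulmx1. Qed.

Section rdot.
Variables k m : nat.
Implicit Types (X Y Z : 'M[R]_(k, m)) (e : 'cV[R]_k).

Lemma rscaleE e Z i j : rscale e Z i j = e i 0 * Z i j.
Proof.
rewrite mxE (bigD1 i)//= !mxE eqxx mulr1n big1 ?addr0// => l /negPf li.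
by rewrite !mxE eq_sym li mulr0n mul0r.
Qed.

Lemma rscaleDl e e' Z : rscale (e + e') Z = rscale e Z + rscale e' Z.
Proof. by rewrite /rscale raddfD raddfD/= mulmxDl. Qed.
Lemma rscaleNl e Z : rscale (- e) Z = - rscale e Z.
Proof. by rewrite /rscale raddfN raddfN/= mulNmx. Qed.
Lemma rscaleBl e e' Z : rscale (e - e') Z = rscale e Z - rscale e' Z.
Proof. by rewrite rscaleDl rscaleNl. Qed.
Lemma rscaleBr e Z Y : rscale e (Z - Y) = rscale e Z - rscale e Y.
Proof. exact: mulmxBr. Qed.

Lemma rdotC X Y : rdot X Y = rdot Y X.
Proof. by apply/colP => i; rewrite !mxE; apply: eq_bigr => j _; rewrite mulrC. Qed.
Lemma rdotDl X Y Z : rdot (X + Y) Z = rdot X Z + rdot Y Z.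
Proof.
apply/colP => i; rewrite !mxE -big_split; apply: eq_bigr => j _ /=.
by rewrite mxE mulrDl.
Qed.
Lemma rdotZl c X Y : rdot (c *: X) Y = c *: rdot X Y.
Proof.
by apply/colP => i; rewrite !mxE mulr_sumr; apply: eq_bigr => j _; rewrite mxE mulrA.
Qed.
Lemma rdotNl X Y : rdot (- X) Y = - rdot X Y.
Proof. by rewrite -scaleN1r rdotZl scaleN1r. Qed.
Lemma rdotBl X Y Z : rdot (X - Y) Z = rdot X Z - rdot Y Z.
Proof. by rewrite rdotDl rdotNl. Qed.
Lemma rdotDr X Y Z : rdot Z (X + Y) = rdot Z X + rdot Z Y.
Proof. by rewrite !(rdotC Z) rdotDl. Qed.
Lemma rdotZr c X Y : rdot X (c *: Y) = c *: rdot X Y.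
Proof. by rewrite !(rdotC X) rdotZl. Qed.
Lemma rdotBr X Y Z : rdot Z (X - Y) = rdot Z X - rdot Z Y.
Proof. by rewrite !(rdotC Z) rdotBl. Qed.

Lemma rdotNr X Y : rdot X (- Y) = - rdot X Y.
Proof. by rewrite !(rdotC X) rdotNl. Qed.
Lemma rdot0l X : rdot 0 X = 0.
Proof. by rewrite -(subrr X) rdotBl subrr. Qed.

Lemma fdot_rdot e X Y : fdot e (rdot X Y) = fdot (rscale e X) Y.
Proof.
rewrite !fdotE; apply: eq_bigr => i _; rewrite big_ord1 mxE mulr_sumr.
by apply: eq_bigr => j _; rewrite rscaleE mulrA.
Qed.

Lemma fnorm_diag e : fnorm (diag_mx e^T) = fnorm e.
Proof.
rewrite -[in RHS](fnorm_tr e) /fnorm !fdotE big_ord1; congr Num.sqrt.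
apply: eq_bigr => i _.
rewrite (bigD1 i)//= big1 ?addr0 ?mxE ?eqxx ?mulr1n// => j /negPf ji.
by rewrite !mxE eq_sym ji mulr0n mul0r.
Qed.

Lemma fnorm_rscale e Z : fnorm (rscale e Z) <= fnorm e * fnorm Z.
Proof.
by rewrite (le_trans (fnorm_mul _ _))// fnorm_diag.
Qed.

Lemma fnorm_rdot X Y : fnorm (rdot X Y) <= fnorm X * fnorm Y.
Proof.
have [->|d0] := eqVneq (fnorm (rdot X Y)) 0.
  by rewrite mulr_ge0 ?fnorm_ge0.
rewrite -(@ler_pM2l _ (fnorm (rdot X Y))); last first.
  by rewrite lt_neqAle eq_sym d0 fnorm_ge0.
rewrite -expr2 fnormsq fdot_rdot (le_trans (fdot_le _ _))// mulrA.
by rewrite ler_wpM2r ?fnorm_ge0// fnorm_rscale.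
Qed.

Lemma rdot_orth X Y (Q : 'M[R]_m) :
  Q *m Q^T = 1%:M -> rdot (X *m Q) (Y *m Q) = rdot X Y.
Proof.
have rdotE A C i : rdot A C i 0 = (A *m C^T) i i :> R.
  by rewrite !mxE; apply: eq_bigr => j _; rewrite mxE.
move=> Q1; apply/colP => i.
by rewrite !rdotE trmx_mul mulmxA -(mulmxA X) Q1 mulmx1.
Qed.

End rdot.

End Frobenius.

(** * Stacked vectors as matrices *)

Section Stacking.
Variable R : realType.

Definition unstack (k m : nat) (x : 'cV[R]_(k * m)) : 'M[R]_(k, m) :=
  \matrix_(i, a) x (mxtens_index (i, a)) 0.
Definition stack (k m : nat) (X : 'M[R]_(k, m)) : 'cV[R]_(k * m) :=
  \col_r X (mxtens_unindex r).1 (mxtens_unindex r).2.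

Lemma stackK k m : cancel (@stack k m) (@unstack k m).
Proof. by move=> X; apply/matrixP => i j; rewrite !mxE mxtens_indexK. Qed.
Lemma unstackK k m : cancel (@unstack k m) (@stack k m).
Proof.
by move=> x; apply/colP => r; rewrite !mxE -surjective_pairing mxtens_unindexK.
Qed.

Lemma sum_mxtens k m (F : 'I_(k * m) -> R) :
  \sum_r F r = \sum_i \sum_a F (mxtens_index (i, a)).
Proof.
rewrite pair_big/= (reindex (@mxtens_index k m))/=; last first.
  by exists (@mxtens_unindex k m) => ? _;
     [exact: mxtens_indexK|exact: mxtens_unindexK].
by apply: eq_bigr => -[].
Qed.

Lemma unstackD k m (x y : 'cV[R]_(k * m)) : unstack (x + y) = unstack x + unstack y.
Proof. by apply/matrixP => i a; rewrite !mxE. Qed.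
Lemma unstackN k m (x : 'cV[R]_(k * m)) : unstack (- x) = - unstack x.
Proof. by apply/matrixP => i a; rewrite !mxE. Qed.
Lemma unstackB k m (x y : 'cV[R]_(k * m)) : unstack (x - y) = unstack x - unstack y.
Proof. by rewrite unstackD unstackN. Qed.
Lemma stackD k m (X Y : 'M[R]_(k, m)) : stack (X + Y) = stack X + stack Y.
Proof. by apply/colP => r; rewrite !mxE. Qed.
Lemma stackZ k m c (X : 'M[R]_(k, m)) : stack (c *: X) = c *: stack X.
Proof. by apply/colP => r; rewrite !mxE. Qed.

Lemma unstack_bar k l m (A : 'M[R]_(k, l)) (x : 'cV[R]_(l * m)) :
  unstack (bar m A *m x) = A *m unstack x.
Proof.
apply/matrixP => i a; rewrite !mxE sum_mxtens; apply: eq_bigr => j _.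
rewrite (bigD1 a)//= tensmxE !mxE eqxx mulr1 big1 ?addr0// => b /negPf ba.
by rewrite tensmxE mxE eq_sym ba mulr0 mul0r.
Qed.

Lemma unstack_barT k l m (A : 'M[R]_(k, l)) (x : 'cV[R]_(k * m)) :
  unstack ((bar m A)^T *m x) = A^T *m unstack x.
Proof. by rewrite /bar trmx_tens trmx1 -/(bar m A^T) unstack_bar. Qed.

Lemma unstack_rot k m (Q : 'M[R]_m) (x : 'cV[R]_(k * m)) :
  unstack (tensmx (1%:M : 'M[R]_k) Q *m x) = unstack x *m Q^T.
Proof.
apply/matrixP => i a; rewrite !mxE sum_mxtens (bigD1 i)//= [X in _ + X]big1.
  rewrite addr0; apply: eq_bigr => b _.
  by rewrite tensmxE !mxE eqxx mul1r mulrC.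
move=> j /negPf ji; apply: big1 => b _.
by rewrite tensmxE mxE eq_sym ji !mul0r.
Qed.

Lemma unstack_blkdiag k m (z : 'cV[R]_(k * m)) (e : 'cV[R]_k) :
  unstack (blkdiag z *m e) = rscale e (unstack z).
Proof.
apply/matrixP => i a; rewrite rscaleE !mxE (bigD1 i)//= !mxE mxtens_indexK/= eqxx.
rewrite mulrC big1 ?addr0// => j /negPf ji.
by rewrite !mxE mxtens_indexK/= eq_sym ji mul0r.
Qed.

Lemma blkdiagT_mul k m (z y : 'cV[R]_(k * m)) :
  (blkdiag z)^T *m y = rdot (unstack z) (unstack y).
Proof.
apply/colP => i; rewrite !mxE sum_mxtens (bigD1 i)//= [X in _ + X]big1 ?addr0.
  by apply: eq_bigr => a _; rewrite !mxE mxtens_indexK eqxx.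
move=> j /negPf ji; apply: big1 => b _.
by rewrite !mxE mxtens_indexK/= ji mul0r.
Qed.

Lemma enormE k (x : 'cV[R]_k) : enorm x = fnorm x.
Proof.
rewrite /enorm /fnorm fdotE; congr Num.sqrt.
by apply: eq_bigr => i _; rewrite big_ord1 expr2.
Qed.

Lemma fnorm_unstack k m (x : 'cV[R]_(k * m)) : fnorm (unstack x) = fnorm x.
Proof.
rewrite /fnorm !fdotE sum_mxtens; congr Num.sqrt.
by do 2![apply: eq_bigr => ? _]; rewrite big_ord1 !mxE.
Qed.

Lemma blkE k m (x : 'cV[R]_(k * m)) i : blk x i = (row i (unstack x))^T.
Proof. by apply/colP => a; rewrite !mxE. Qed.

End Stacking.

(** * Angular velocities as skew matrices *)

Section Cross.
Variable R : realType.
Implicit Types w : 'cV[R]_3.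

Lemma cross_mxT m w : (cross_mx m w)^T = - cross_mx m w.
Proof.
apply/matrixP => -[i Hi] [j Hj]; rewrite !mxE/=.
by case: i Hi => [|[|[|i]]] Hi; case: j Hj => [|[|[|j]]] Hj;
   rewrite ?oppr0 ?opprK.
Qed.

Lemma cross_mx_linear m : linear (@cross_mx R m).
Proof.
move=> c v w; apply/matrixP => -[i Hi] [j Hj]; rewrite !mxE/=.
by case: i Hi => [|[|[|i]]] Hi; case: j Hj => [|[|[|j]]] Hj;
   rewrite ?mulr0 ?addr0// mulrN opprD.
Qed.
HB.instance Definition _ m :=
  GRing.isLinear.Build R 'cV[R]_3 'M[R]_m _ (@cross_mx R m) (@cross_mx_linear m).

Lemma cross_mx3_sq w : cross_mx 3 w *m cross_mx 3 w = w *m w^T - (fdot w w)%:M.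
Proof.
have ord3E (F : 'I_3 -> R) : \sum_i F i = F (inord 0) + F (inord 1) + F (inord 2).
  rewrite !big_ord_recl big_ord0 addr0 addrA.
  by congr (F _ + F _ + F _); apply: val_inj; rewrite /= inordK.
rewrite fdotE !ord3E !big_ord1.
apply/matrixP => i j; rewrite !mxE ord3E !big_ord1 !mxE !inordK//=.
have wE (k : 'I_3) l : nat_of_ord k = l -> w k 0 = w (inord l) 0.
  by move=> <-; rewrite inord_val.
case: i => -[|[|[|i]]] Hi //=; case: j => -[|[|[|j]]] Hj //=;
 rewrite -?val_eqE/= ?mulr1n ?mulr0n ?(wE (Ordinal Hi) _ erefl)
 ?(wE (Ordinal Hj) _ erefl) /=; ring.
Qed.

(** A skew matrix in dimension two or three satisfies a cubic equation, so its
    exponential is a quadratic polynomial in it. *)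
Lemma cross_mx_cube m w : m = 2%N \/ m = 3%N ->
  exists2 s : R, cross_mx m w *m cross_mx m w *m cross_mx m w =
                 - s ^+ 2 *: cross_mx m w & (s = 0 -> cross_mx m w = 0).
Proof.
case=> ->.
  exists (w (inord 2) 0); last first.
    move=> w0; apply/matrixP => -[i Hi] [j Hj]; rewrite !mxE/= w0 oppr0.
    by case: i Hi => [|[|i]] Hi //; case: j Hj => [|[|j]] Hj.
  have sq : cross_mx 2 w *m cross_mx 2 w = (- w (inord 2) 0 ^+ 2)%:M.
    apply/matrixP => -[i Hi] [j Hj]; rewrite !mxE !big_ord_recl big_ord0 !mxE/=.
    case: i Hi => [|[|i]] Hi //; case: j Hj => [|[|j]] Hj //=;
    by rewrite -?val_eqE/= ?mulr1n ?mulr0n ; ring.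
  by rewrite sq mul_scalar_mx.
exists (fnorm w); last first.
  move/fnorm_eq0 => ->; exact: linear0.
rewrite cross_mx3_sq mulmxBl mul_scalar_mx fnormsq -mulmxA.
suff -> : w^T *m cross_mx 3 w = 0 by rewrite mulmx0 sub0r scaleNr.
have ord3E (F : 'I_3 -> R) : \sum_i F i = F (inord 0) + F (inord 1) + F (inord 2).
  rewrite !big_ord_recl big_ord0 addr0 addrA.
  by congr (F _ + F _ + F _); apply: val_inj; rewrite /= inordK.
apply/matrixP => i j; rewrite ord1 !mxE ord3E !mxE !inordK//=.
by case: j => -[|[|[|j]]] Hj //=; ring.
Qed.

End Cross.

(** * Infinitesimal rigidity *)

Section Rigidity.
Variables (R : realType) (n m q : nat) (G : sensing_graph n q).
Let B := incidence R G.

(** A velocity field on the configuration, not a displacement. *)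
Definition rigid_motion (P : 'M[R]_(n, m)) (w : 'cV[R]_3) (v : 'cV[R]_m) :
  'M[R]_(n, m) := (const_mx 1 : 'cV_n) *m v^T + P *m (cross_mx m w)^T.

Lemma incidenceT_const : B^T *m (const_mx 1 : 'cV_n) = 0.
Proof.
apply/colP => k; rewrite !mxE.
have := edge_irrefl G k; set i := etail G k; set j := ehead G k => ij.
rewrite (bigD1 i)//= (bigD1 j)/=; last by rewrite eq_sym.
rewrite !mxE eqxx (negPf (_ : j != i)) ?eqxx; last by rewrite eq_sym.
rewrite big1 ?addr0; first by rewrite !mulr1 subrr.
by move=> l /andP[/negPf li /negPf lj]; rewrite !mxE li lj mul0r.
Qed.

Lemma incidenceT_rigid_motion P w v :
  B^T *m rigid_motion P w v = (B^T *m P) *m (cross_mx m w)^T.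
Proof.
by rewrite /rigid_motion mulmxDr mulmxA incidenceT_const mul0mx add0r mulmxA.
Qed.

Lemma rdot_cross k (Z : 'M[R]_(k, m)) w : rdot Z (Z *m (cross_mx m w)^T) = 0.
Proof.
apply/colP => i; rewrite !mxE.
pose r := row i Z.
have -> : \sum_j Z i j * (Z *m (cross_mx m w)^T) i j =
          fdot r (r *m (cross_mx m w)^T).
  by rewrite fdotE big_ord1; apply: eq_bigr => j _; rewrite -row_mul !mxE.
have : fdot r (r *m (cross_mx m w)^T) = fdot r (r *m cross_mx m w).
  by rewrite -fdot_mulr fdotC.
have : fdot r (r *m (cross_mx m w)^T) = - fdot r (r *m cross_mx m w).
  by rewrite cross_mxT mulmxN fdotNr.
by lra.
Qed.

Lemma rigidity_mxE (p x : 'cV[R]_(n * m)) :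
  rigidity_mx G (relpos G p) *m x = rdot (B^T *m unstack p) (B^T *m unstack x).
Proof. by rewrite /rigidity_mx -mulmxA blkdiagT_mul !unstack_barT. Qed.

(** The parameter space of rigid motions embeds in the kernel of the rigidity
    matrix; when it has the dimension of the kernel it fills it.  Since not all
    angular velocities act in dimension two, W selects k of them. *)
Lemma ker_rigidity_gen k (W : 'M[R]_(3, k)) (p : 'cV[R]_(n * m)) :
  (0 < n)%N -> (n * m - rigid_rank n m = k + m)%N -> inf_rigid G p ->
  (forall c, B^T *m unstack p *m (cross_mx m (W *m c))^T = 0 -> c = 0) ->
  forall X, rdot (B^T *m unstack p) (B^T *m X) = 0 ->
    exists w v, X = rigid_motion (unstack p) w v.
Proof.
move=> n0 dimE rk inj X X0.
pose f (u : 'rV[R]_(k + m)) : 'rV[R]_(n * m) :=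
  (stack (rigid_motion (unstack p) (W *m (lsubmx u)^T) (rsubmx u)^T))^T.
have f_lin : linear f.
  move=> c u v; rewrite /f /rigid_motion !linearP/= addrACA -scalerDr.
  by rewrite stackD stackZ [LHS]raddfD/= linearZ.
pose F : {linear 'rV[R]_(k + m) -> 'rV[R]_(n * m)} :=
  HB.pack f (GRing.isLinear.Build _ _ _ _ f f_lin).
pose Rm := rigidity_mx G (relpos G p).
have kerP x : (x *m Rm^T == 0) =
    (rdot (B^T *m unstack p) (B^T *m unstack x^T) == 0).
  by rewrite -trmx_eq0 trmx_mul trmxK rigidity_mxE.
have T_ker : (lin1_mx F <= kermx Rm^T)%MS.
  apply/sub_kermxP/row_matrixP => i; rewrite row0 row_mul rowE.
  apply/eqP; rewrite mul_rV_lin1/= kerP trmxK stackK.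
  by rewrite incidenceT_rigid_motion rdot_cross.
have T_free : row_free (lin1_mx F).
  rewrite -kermx_eq0; apply/rowV0P => u /sub_kermxP; rewrite mul_rV_lin1/=.
  move=> /(congr1 trmx); rewrite trmxK trmx0 => /(congr1 (@unstack R _ _)).
  rewrite stackK => mot0.
  have {}mot0 : rigid_motion (unstack p) (W *m (lsubmx u)^T) (rsubmx u)^T = 0.
    by rewrite mot0; apply/matrixP => i j; rewrite !mxE.
  have l0 : (lsubmx u)^T = 0.
    by apply: inj; rewrite -(incidenceT_rigid_motion _ _ (rsubmx u)^T) mot0 mulmx0.
  have r0 : rsubmx u = 0.
    move: mot0; rewrite /rigid_motion l0 mulmx0 linear0 trmx0 mulmx0 addr0 trmxK.
    move=> /matrixP mot0; apply/rowP => a; have := mot0 (Ordinal n0) a.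
    by rewrite !mxE big_ord1 !mxE mul1r.
  by rewrite -[u]hsubmxK r0 -[lsubmx u]trmxK l0 trmx0 row_mx0.
have TE : (kermx Rm^T <= lin1_mx F)%MS.
  have := mxrank_leqif_eq T_ker; rewrite mxrank_ker mxrank_tr.
  rewrite rk dimE (eqP T_free) => -[_ /esym].
  by rewrite eqxx => /eqmxP ->.
have : ((stack X)^T <= kermx Rm^T)%MS.
  by apply/sub_kermxP/eqP; rewrite kerP trmxK stackK X0.
move=> /submx_trans/(_ TE)/submxP[u]; rewrite mul_rV_lin1/= => Xu.
exists (W *m (lsubmx u)^T), (rsubmx u)^T.
by apply: (can_inj (@stackK R n m)); apply: trmx_inj.
Qed.

(** For collinear relative positions the rigidity matrix factors through the
    transposed incidence matrix, which annihilates constant vectors. *)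
Lemma rank_collinear (p : 'cV[R]_(n * m)) (l : 'cV[R]_q) (w : 'cV[R]_m) :
  (0 < n)%N -> B^T *m unstack p = l *m w^T ->
  (\rank (rigidity_mx G (relpos G p)) < n)%N.
Proof.
move=> n0 Zl.
pose Mw : 'M[R]_(n, n * m) :=
  \matrix_(i, r) (((mxtens_unindex r).1 == i)%:R * w (mxtens_unindex r).2 0).
have MwE x : Mw *m x = unstack x *m w.
  apply/colP => i; rewrite !mxE sum_mxtens (bigD1 i)//= [X in _ + X]big1.
    by rewrite addr0; apply: eq_bigr => a _; rewrite !mxE mxtens_indexK eqxx mul1r mulrC.
  move=> j /negPf ji; apply: big1 => a _.
  by rewrite !mxE mxtens_indexK/= ji !mul0r.
have -> : rigidity_mx G (relpos G p) = diag_mx l^T *m B^T *m Mw.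
  suff actE : forall x : 'cV[R]_(n * m),
      rigidity_mx G (relpos G p) *m x = diag_mx l^T *m B^T *m Mw *m x.
    by apply/trmx_inj/row_matrixP => i; rewrite -!tr_col !colE actE.
  move=> x; rewrite rigidity_mxE Zl -!mulmxA MwE.
  apply/colP => k; rewrite -/(rscale _ _) rscaleE mulmxA [in RHS]mxE mulr_sumr mxE.
  by apply: eq_bigr => a _; rewrite [in LHS]mxE big_ord1 [w^T _ _]mxE mulrAC mulrA.
rewrite (leq_ltn_trans (mxrankM_maxl _ _))//.
rewrite (leq_ltn_trans (mxrankM_maxr _ _))// mxrank_tr.
rewrite ltn_neqAle rank_leq_row andbT; apply/negP => /row_freeP[D BD].
have : (const_mx 1 : 'cV[R]_n)^T = 0.
  rewrite -[_^T]mulmx1 -BD mulmxA -[B]trmxK -trmx_mul incidenceT_const.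
  by rewrite trmx0 mul0mx.
by move=> /rowP/(_ (Ordinal n0)); rewrite !mxE => /eqP; rewrite oner_eq0.
Qed.

End Rigidity.

(** A nonzero angular velocity fixing all relative positions would make the
    agents collinear in space, coincident in the plane, and the rank of the
    rigidity matrix would be too small.  So rigid motions are determined by their
    parameters and fill the kernel.  Two agents in space form the case without
    edges. *)
Lemma ker_rigidity (R : realType) (n m q : nat) (G : sensing_graph n q)
    (p : 'cV[R]_(n * m)) :
  (2 <= n)%N -> m = 2%N \/ m = 3%N -> inf_min_rigid G p ->
  forall X, rdot ((incidence R G)^T *m unstack p) ((incidence R G)^T *m X) = 0 ->
    q = 0%N \/ exists w v, X = rigid_motion (unstack p) w v.
Proof.
move=> n2 m23 [rk qE] X X0; have n0 : (0 < n)%N by exact: ltn_trans n2.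
case: (eqVneq q 0%N) => [|q0]; [by left|right].
case: m23 => m_eq; subst m; rewrite /rigid_rank/= in qE.
  apply: (@ker_rigidity_gen _ _ _ _ G 1 (delta_mx (inord 2) 0)) => //.
    by rewrite /rigid_rank/=; lia.
  move=> c; set u := _ *m c => /matrixP Z0.
  have uE : u (inord 2) 0 = c 0 0.
    by rewrite /u mxE big_ord1 mxE !eqxx mul1r.
  apply/colP => i; rewrite ord1 [RHS]mxE -uE; apply/eqP/negPn/negP => uN0.
  suff : \rank (rigidity_mx G (relpos G p)) = 0%N.
    by rewrite rk /rigid_rank/=; lia.
  apply/eqP; rewrite mxrank_eq0; apply/eqP.
  suff Zp0 : (incidence R G)^T *m unstack p = 0.
    apply/trmx_inj/row_matrixP => j; rewrite -!tr_col !colE rigidity_mxE Zp0.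
    by rewrite !mul0mx rdot0l.
  apply/matrixP => k a.
  have := Z0 k 0; have := Z0 k 1; rewrite !mxE !big_ord_recl !big_ord0.
  rewrite ![_^T _ _]mxE ![cross_mx _ _ _ _]mxE/=.
  rewrite !(mulr0, addr0, add0r) mulrN => /eqP; rewrite mulf_eq0 (negPf uN0) orbF.
  move=> /eqP E0 /eqP; rewrite oppr_eq0 mulf_eq0 (negPf uN0) orbF => /eqP E1.
  case: a => -[|[|a]] Ha //; [rewrite -[RHS]E0|rewrite -[RHS]E1];
    by rewrite mxE; apply: eq_bigr => ? _; congr (_ * unstack _ _ _); apply: val_inj.
apply: (@ker_rigidity_gen _ _ _ _ G 3 1%:M) => //.
  by rewrite /rigid_rank/=; lia.
move=> w; rewrite mul1mx => w0; apply: fnorm_eq0; apply/eqP/negPn/negP => wN0.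
suff : (\rank (rigidity_mx G (relpos G p)) < n)%N by rewrite rk /rigid_rank/=; lia.
pose Z := (incidence R G)^T *m unstack p.
have : Z *m ((cross_mx 3 w)^T *m (cross_mx 3 w)^T) = 0.
  by rewrite mulmxA w0 mul0mx.
rewrite -trmx_mul cross_mx3_sq raddfB/= trmx_mul trmxK tr_scalar_mx mulmxBr mul_mx_scalar.
move/eqP; rewrite subr_eq0 => /eqP Zw.
apply: (@rank_collinear _ _ _ _ G p ((fnorm w ^- 2) *: (Z *m w)) w) => //.
rewrite -scalemxAl -mulmxA Zw -fnormsq scalerA mulVf ?scale1r//.
by rewrite expf_eq0.
Qed.

(** * Small fixed points of maps that vanish to second order *)

Section BoundedAdditive.
Variable R : realType.

(** Additivity is stated with differences, the form in which it is used. *)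
Definition bounded_additive (c d c' d' : nat)
    (L : 'M[R]_(c, d) -> 'M[R]_(c', d')) : Prop :=
  (forall x y, L (x - y) = L x - L y) /\
  exists2 M, 0 <= M & forall x, fnorm (L x) <= M * fnorm x.

Variables c d : nat.

Lemma bounded_mull c' (A : 'M[R]_(c', c)) :
  bounded_additive (fun X : 'M[R]_(c, d) => A *m X).
Proof.
split=> [x y|]; first by rewrite mulmxBr.
by exists (fnorm A); rewrite ?fnorm_ge0// => x; exact: fnorm_mul.
Qed.

Lemma bounded_mulr d' (A : 'M[R]_(d, d')) :
  bounded_additive (fun X : 'M[R]_(c, d) => X *m A).
Proof.
split=> [x y|]; first by rewrite mulmxBl.
by exists (fnorm A); rewrite ?fnorm_ge0// => x; rewrite mulrC; exact: fnorm_mul.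
Qed.

Lemma bounded_opp : bounded_additive (fun X : 'M[R]_(c, d) => - X).
Proof.
split=> [x y|]; first by rewrite opprD.
by exists 1 => // x; rewrite fnormN mul1r.
Qed.

Lemma bounded_tr : bounded_additive (fun X : 'M[R]_(c, d) => X^T).
Proof.
split=> [x y|]; first by rewrite raddfB.
by exists 1 => // x; rewrite fnorm_tr mul1r.
Qed.

Lemma bounded_rdotl (Z : 'M[R]_(c, d)) : bounded_additive (fun X => rdot Z X).
Proof.
split=> [x y|]; first by rewrite rdotBr.
by exists (fnorm Z); rewrite ?fnorm_ge0// => x; exact: fnorm_rdot.
Qed.

Lemma bounded_rscale (Z : 'M[R]_(c, d)) : bounded_additive (fun e => rscale e Z).
Proof.
split=> [x y|]; first by rewrite rscaleBl.
exists (fnorm Z); rewrite ?fnorm_ge0// => x; rewrite mulrC; exact: fnorm_rscale.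
Qed.

Lemma bounded_diag : bounded_additive (fun e : 'cV[R]_c => diag_mx e^T).
Proof.
split=> [x y|]; first by rewrite !raddfB.
by exists 1 => // x; rewrite fnorm_diag mul1r.
Qed.

End BoundedAdditive.

Section SecondOrder.
Variables (R : realType) (a b : nat).
Local Notation E := 'M[R]_(a, b).

Definition lip0 (c d : nat) (f : E -> 'M[R]_(c, d)) : Prop :=
  f 0 = 0 /\ exists2 K, 0 <= K & forall x y, fnorm x <= 1 -> fnorm y <= 1 ->
    fnorm (f x - f y) <= K * fnorm (x - y).

(** On balls of radius r the Lipschitz constant is at most proportional to r, as
    for a polynomial map without linear part. *)
Definition second_order (c d : nat) (f : E -> 'M[R]_(c, d)) : Prop :=
  f 0 = 0 /\ exists2 K, 0 <= K & forall r x y,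
    r <= 1 -> fnorm x <= r -> fnorm y <= r ->
    fnorm (f x - f y) <= K * r * fnorm (x - y).

Lemma second_order_lip0 c d (f : E -> 'M[R]_(c, d)) : second_order f -> lip0 f.
Proof.
move=> [f0 [K K0 Kf]]; split=> //; exists K => // x y x1 y1.
by rewrite -[K]mulr1 Kf.
Qed.

Lemma lip0_bound c d (f : E -> 'M[R]_(c, d)) : lip0 f ->
  exists2 K, 0 <= K & forall x, fnorm x <= 1 -> fnorm (f x) <= K * fnorm x.
Proof.
move=> [f0 [K K0 Kf]]; exists K => // x x1.
by have := Kf x 0 x1; rewrite f0 !subr0 fnorm0; apply.
Qed.

Lemma lip0_lin c d c' d' (L : 'M[R]_(c, d) -> 'M[R]_(c', d'))
  (f : E -> 'M[R]_(c, d)) : bounded_additive L -> lip0 f -> lip0 (fun x => L (f x)).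
Proof.
move=> [LB [M M0 LM]] [f0 [K K0 Kf]]; split; first by rewrite f0 -(subrr 0) LB subrr.
exists (M * K) => [|x y x1 y1]; first by rewrite mulr_ge0.
by rewrite -LB (le_trans (LM _))// -mulrA ler_wpM2l// Kf.
Qed.

Lemma second_order_lin c d c' d' (L : 'M[R]_(c, d) -> 'M[R]_(c', d'))
    (f : E -> 'M[R]_(c, d)) :
  bounded_additive L -> second_order f -> second_order (fun x => L (f x)).
Proof.
move=> [LB [M M0 LM]] [f0 [K K0 Kf]]; split; first by rewrite f0 -(subrr 0) LB subrr.
exists (M * K) => [|r x y r1 x1 y1]; first by rewrite mulr_ge0.
by rewrite -LB (le_trans (LM _))// -!mulrA ler_wpM2l// mulrA Kf.
Qed.

Lemma lip0_id : lip0 (id : E -> E).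
Proof. by split=> //; exists 1 => // x y _ _; rewrite mul1r. Qed.

Lemma lip0D c d (f g : E -> 'M[R]_(c, d)) :
  lip0 f -> lip0 g -> lip0 (fun x => f x + g x).
Proof.
move=> [f0 [K K0 Kf]] [g0 [L L0 Lg]]; split; first by rewrite f0 g0 addr0.
exists (K + L) => [|x y xr yr]; first by rewrite addr_ge0.
by rewrite opprD addrACA (le_trans (fnormD _ _))// mulrDl lerD ?Kf ?Lg.
Qed.

Lemma second_orderD c d (f g : E -> 'M[R]_(c, d)) :
  second_order f -> second_order g -> second_order (fun x => f x + g x).
Proof.
move=> [f0 [K K0 Kf]] [g0 [L L0 Lg]]; split; first by rewrite f0 g0 addr0.
exists (K + L) => [|r x y r1 xr yr]; first by rewrite addr_ge0.
rewrite opprD addrACA (le_trans (fnormD _ _))// !mulrDl.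
by rewrite lerD ?Kf ?Lg.
Qed.

Lemma second_orderN c d (f : E -> 'M[R]_(c, d)) :
  second_order f -> second_order (fun x => - f x).
Proof.
exact: second_order_lin (bounded_opp _ _ _).
Qed.

(** The product rule for differences: each of the two terms contains one factor
    that is of the size of the ball. *)
Lemma second_order_bilin c d c' d' c'' d''
    (P : 'M[R]_(c, d) -> 'M[R]_(c', d') -> 'M[R]_(c'', d'')) M
    (f : E -> 'M[R]_(c, d)) (g : E -> 'M[R]_(c', d')) :
  0 <= M ->
  (forall x y z, P (x - y) z = P x z - P y z) ->
  (forall x y z, P z (x - y) = P z x - P z y) ->
  (forall x y, fnorm (P x y) <= M * (fnorm x * fnorm y)) ->
  lip0 f -> lip0 g -> second_order (fun x => P (f x) (g x)).
Proof.
move=> M0 PBl PBr PM fl gl; have [Kf Kf0 fK] := lip0_bound fl.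
have [Kg Kg0 gK] := lip0_bound gl.
case: fl gl => [f0 [K K0 Lf]] [g0 [L L0 Lg]]; split.
  by rewrite f0 -(subrr 0) PBl subrr.
exists (M * (K * Kg + Kf * L)) => [|r x y r1 xr yr].
  by rewrite mulr_ge0 ?addr_ge0 ?mulr_ge0.
have x1 := le_trans xr r1; have y1 := le_trans yr r1.
have -> : P (f x) (g x) - P (f y) (g y) = P (f x - f y) (g x) + P (f y) (g x - g y).
  by rewrite PBl PBr addrA subrK.
rewrite (le_trans (fnormD _ _))// -!mulrA.
rewrite (le_trans (lerD (PM _ _) (PM _ _)))// -mulrDr ler_wpM2l// mulrDl lerD//.
  rewrite (@le_trans _ _ ((K * fnorm (x - y)) * (Kg * r)))//; last first.
    by rewrite le_eqVlt; apply/orP; left; apply/eqP; ring.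
  by rewrite ler_pM ?fnorm_ge0 ?Lf// (le_trans (gK _ _))// ler_wpM2l.
rewrite (@le_trans _ _ ((Kf * r) * (L * fnorm (x - y))))//; last first.
  by rewrite le_eqVlt; apply/orP; left; apply/eqP; ring.
by rewrite ler_pM ?fnorm_ge0 ?Lg// (le_trans (fK _ _))// ler_wpM2l.
Qed.

Lemma second_order_mul c d d' (f : E -> 'M[R]_(c, d)) (g : E -> 'M[R]_(d, d')) :
  lip0 f -> lip0 g -> second_order (fun x => f x *m g x).
Proof.
apply: (@second_order_bilin _ _ _ _ _ _ (fun x y => x *m y) 1) => //.
- by move=> x y z; rewrite mulmxBl.
- by move=> x y z; rewrite mulmxBr.
- by move=> x y; rewrite mul1r fnorm_mul.
Qed.

Lemma second_order_rdot c d (f g : E -> 'M[R]_(c, d)) :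
  lip0 f -> lip0 g -> second_order (fun x => rdot (f x) (g x)).
Proof.
apply: (@second_order_bilin _ _ _ _ _ _ (fun x y => rdot x y) 1) => //.
- by move=> x y z; rewrite rdotBl.
- by move=> x y z; rewrite rdotBr.
- by move=> x y; rewrite mul1r fnorm_rdot.
Qed.

End SecondOrder.

(** Banach's theorem is stated for complete normed modules. *)
HB.instance Definition _ (R : realType) (a b : nat) :=
  Uniform_isComplete.Build 'M[R]_(a, b) (@cauchy_cvg 'M[R]_(a, b)).

(** Banach's theorem on a small ball, in the norm for which matrices form a
    complete normed module; it is equivalent to the Frobenius norm. *)
Lemma small_fixed_point (R : realType) (a b : nat)
    (g : 'M[R]_(a, b) -> 'M[R]_(a, b)) :
  second_order g -> forall rho : R, 0 < rho ->
  exists2 eps : R, 0 < eps & forall h, fnorm h <= eps ->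
    exists2 u, fnorm u <= rho & u = g u + h.
Proof.
move=> [g0 [K K0 Kg]] rho rho0.
set s : R := Num.sqrt (a * b)%:R + 1.
have s1 : 1 <= s by rewrite lerDr sqrtr_ge0.
have s0 : 0 < s by rewrite (lt_le_trans _ s1).
have sE (x : 'M[R]_(a, b)) : fnorm x <= s * `|x|.
  by rewrite (le_trans (fnorm_le_normr x))// ler_wpM2r// lerDl.
pose r := Num.min (s^-1) (Num.min (rho / s) ((2 * (K + 1) * s ^+ 2)^-1)).
have K1 : 0 < K + 1 by rewrite ltr_wpDl.
have d0 : 0 < 2 * (K + 1) * s ^+ 2 by rewrite !mulr_gt0 ?exprn_gt0.
have r0 : 0 < r by rewrite !lt_min !invr_gt0 s0 d0 divr_gt0.
have rs : s * r <= 1.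
  by rewrite mulrC -ler_pdivlMr// div1r ge_min lexx.
have rrho : s * r <= rho.
  by rewrite mulrC -ler_pdivlMr// /r !ge_min lexx orbT.
have rK : K * (s * r) * s <= 2^-1.
  have : r <= (2 * (K + 1) * s ^+ 2)^-1 by rewrite /r !ge_min lexx !orbT.
  rewrite -[(_)^-1]mul1r ler_pdivlMr// => H.
  have : 0 <= s ^+ 2 * r by rewrite mulr_ge0 ?exprn_ge0// ltW.
  rewrite -(@ler_pM2l _ 2)// mulfV// => H2.
  have -> : 2 * (K * (s * r) * s) = r * (2 * (K + 1) * s ^+ 2) - 2 * (s ^+ 2 * r) by ring.
  by lra.
have gL (x y : 'M[R]_(a, b)) : `|x| <= r -> `|y| <= r -> `|g x - g y| <= 2^-1 * `|x - y|.
  move=> xr yr; rewrite (le_trans (normr_le_fnorm _))//.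
  have B (z : 'M[R]_(a, b)) : `|z| <= r -> fnorm z <= s * r.
    by move=> zr; rewrite (le_trans (sE z))// ler_wpM2l// ltW.
  rewrite (le_trans (Kg (s * r) x y rs (B _ xr) (B _ yr)))//.
  rewrite (@le_trans _ _ (K * (s * r) * (s * `|x - y|)))//.
    by rewrite ler_wpM2l// !mulr_ge0// ltW.
  by rewrite mulrA ler_wpM2r.
exists (r / 2) => [|h hr]; first by rewrite divr_gt0.
pose U : set 'M[R]_(a, b) := closed_ball_ Num.norm 0 r.
have UE x : U x <-> `|x| <= r by rewrite /U/closed_ball_/= sub0r normrN.
have fU : set_fun U U (fun x => g x + h).
  move=> x /UE xr; apply/UE.
  rewrite (le_trans (ler_normD _ _))//.
  have := gL x 0 xr; rewrite normr0 g0 !subr0 => /(_ (ltW r0)) gx.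
  have := le_trans (normr_le_fnorm h) hr.
  by lra.
have [|||u /UE ur uE] := @banach_fixed_point R _ U (mkfun_fun fU) _.
- exists (2^-1)%:nng; split=> /=; first by rewrite invf_lt1// ltr1n.
  move=> [x y] [/= /UE xr /UE yr]; rewrite /mkfun opprD addrACA subrr addr0.
  exact: gL.
- exact: closed_closed_ball_.
- by exists 0; apply/UE; rewrite normr0 ltW.
exists u => //; rewrite (le_trans (sE u))// (le_trans _ rrho)//.
by rewrite ler_wpM2l// ltW.
Qed.

Section Equilibrium.
Variables (R : realType) (n m q : nat) (B S : 'M[R]_(n, q)) (Pd : 'M[R]_(n, m)).
Let Zd := B^T *m Pd.

(** A configuration Z moves rigidly with velocities C Z, the edge errors e being
    constant along the motion, when C solves a quadratic matrix equation and C Z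
    is an infinitesimal motion preserving the lengths of the edges.  Near the
    desired shape and for C near zero, with positions moved only along the range
    of the transposed rigidity matrix, the linear part of these equations is
    invertible: H is the Gram matrix of the rows of the rigidity matrix. *)
Lemma relative_equilibrium (H Hi : 'M[R]_q) :
  (forall x, rdot Zd (B^T *m (B *m rscale x Zd)) = H *m x) -> H *m Hi = 1%:M ->
  forall rho : R, 0 < rho -> exists2 eps : R, 0 < eps &
  forall mu : 'cV[R]_q, fnorm mu <= eps -> exists P C,
    let Z := B^T *m P in
    [/\ fnorm (P - Pd) <= rho, fnorm C <= rho,
        C + C *m B^T *m C + B *m diag_mx (rdot Z Z - rdot Zd Zd)^T
          + S *m diag_mx mu^T = 0 &
        rdot Z (B^T *m (C *m Z)) = 0].
Proof.
move=> HE HHi rho rho0.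
pose X (x : 'cV[R]_q) := B *m rscale (Hi *m x) Zd.
have XE x : rdot Zd (B^T *m X x) = x by rewrite HE mulmxA HHi mul1mx.
(* the unknowns x and C are stacked into one matrix u; E1, E2 extract them and
   J1, J2 put them back *)
pose E1 : 'M[R]_(1, 1 + n) := row_mx 1%:M 0.
pose E2 : 'M[R]_(n, 1 + n) := row_mx 0 1%:M.
pose J1 : 'M[R]_(1 + n, 1) := col_mx 1%:M 0.
pose J2 : 'M[R]_(1 + n, n) := col_mx 0 1%:M.
have EJ : (E1 *m J1 = 1%:M) * (E1 *m J2 = 0) * (E2 *m J1 = 0) * (E2 *m J2 = 1%:M).
  by rewrite !mul_row_col !(mul0mx, mulmx0, mulmx1, addr0, add0r).
pose ze (u : 'M[R]_(1 + n, q)) := B^T *m X (E1 *m u)^T.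
(* the nonlinear parts of the two equations *)
pose N1 u := E2 *m u *m B^T *m (E2 *m u) + B *m diag_mx (rdot (ze u) (ze u))^T.
pose N2 u := rdot (ze u) (B^T *m (E2 *m u *m Zd)) +
  rdot Zd (B^T *m (E2 *m u *m ze u)) + rdot (ze u) (B^T *m (E2 *m u *m ze u)).
(* xh and Ch invert the linear part: they solve C + 2 B diag(x) = f1 and
   rdot Zd (B^T C Zd) = f2 *)
pose xh (f1 : 'M[R]_(n, q)) (f2 : 'cV[R]_q) : 'cV[R]_q :=
  (2^-1 *: Hi) *m (rdot Zd (B^T *m (f1 *m Zd)) - f2).
pose Ch f1 f2 : 'M[R]_(n, q) := f1 - (2 *: B) *m diag_mx (xh f1 f2)^T.
pose Lc f1 f2 := J1 *m (xh f1 f2)^T + J2 *m Ch f1 f2.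
have LcD f1 f2 f1' f2' : Lc (f1 + f1') (f2 + f2') = Lc f1 f2 + Lc f1' f2'.
  have xhD : xh (f1 + f1') (f2 + f2') = xh f1 f2 + xh f1' f2'.
    by rewrite /xh mulmxDl mulmxDr rdotDr opprD addrACA mulmxDr.
  have ChD : Ch (f1 + f1') (f2 + f2') = Ch f1 f2 + Ch f1' f2'.
    by rewrite /Ch xhD addrACA; congr (_ + _); rewrite -opprD -mulmxDr !raddfD.
  by rewrite /Lc xhD ChD [_^T]raddfD !mulmxDr addrACA.
have zeL : lip0 ze.
  do 2 apply: (lip0_lin (bounded_mull _ _)).
  apply: (lip0_lin (bounded_rscale _)); apply: (lip0_lin (bounded_mull _ _)).
  apply: (lip0_lin (bounded_tr _ _ _)); apply: (lip0_lin (bounded_mull _ _)).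
  exact: lip0_id.
have CL : lip0 (fun u : 'M[R]_(1 + n, q) => E2 *m u).
  by apply: (lip0_lin (bounded_mull _ _)); exact: lip0_id.
have N1s : second_order N1.
  apply: second_orderD.
    by apply: second_order_mul => //; exact: (lip0_lin (bounded_mulr _ _) CL).
  apply: (second_order_lin (bounded_mull _ _)).
  apply: (second_order_lin (bounded_diag _ _)).
  exact: second_order_rdot.
have N2s : second_order N2.
  have BCz : second_order (fun u => B^T *m (E2 *m u *m ze u)).
    by apply: (second_order_lin (bounded_mull _ _)); exact: second_order_mul.
  apply: second_orderD; last first.
    by apply: second_order_rdot => //; exact: second_order_lip0.
  apply: second_orderD; last exact: (second_order_lin (bounded_rdotl _)).
  apply: second_order_rdot => //; apply: (lip0_lin (bounded_mull _ _)).
  exact: (lip0_lin (bounded_mulr _ _)).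
have LcL a b (f1 : 'M[R]_(a, b) -> _) f2 :
    lip0 f1 -> lip0 f2 -> lip0 (fun u => - Lc (f1 u) (f2 u)).
  move=> f1L f2L; apply: (lip0_lin (bounded_opp _ _ _)).
  have xhL : lip0 (fun u => xh (f1 u) (f2 u)).
    apply: (lip0_lin (bounded_mull _ _)); apply: lip0D.
      apply: (lip0_lin (bounded_rdotl _)); apply: (lip0_lin (bounded_mull _ _)).
      exact: (lip0_lin (bounded_mulr _ _)).
    exact: (lip0_lin (bounded_opp _ _ _)).
  apply: lip0D.
    by apply: (lip0_lin (bounded_mull _ _)); exact: (lip0_lin (bounded_tr _ _ _)).
  apply: (lip0_lin (bounded_mull _ _)); apply: lip0D => //.
  apply: (lip0_lin (bounded_opp _ _ _)); apply: (lip0_lin (bounded_mull _ _)).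
  exact: (lip0_lin (bounded_diag _ _)).
have gS : second_order (fun u => - Lc (N1 u) (N2 u)).
  apply: second_orderN.
  have xhL : second_order (fun u => xh (N1 u) (N2 u)).
    apply: (second_order_lin (bounded_mull _ _)); apply: second_orderD.
      apply: (second_order_lin (bounded_rdotl _)).
      apply: (second_order_lin (bounded_mull _ _)).
      exact: (second_order_lin (bounded_mulr _ _)).
    exact: second_orderN.
  apply: second_orderD.
    apply: (second_order_lin (bounded_mull _ _)).
    exact: (second_order_lin (bounded_tr _ _ _)).
  apply: (second_order_lin (bounded_mull _ _)); apply: second_orderD => //.
  apply: second_orderN; apply: (second_order_lin (bounded_mull _ _)).
  exact: (second_order_lin (bounded_diag _ _)).
have hL : lip0 (fun mu : 'cV[R]_q => - Lc (S *m diag_mx mu^T) 0).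
  apply: (LcL _ _ (fun mu => S *m diag_mx mu^T) (fun mu => 0)).
    apply: (lip0_lin (bounded_mull _ _)); apply: (lip0_lin (bounded_diag _ _)).
    exact: lip0_id.
  by split=> //; exists 0 => // x y _ _; rewrite subrr fnorm0 mul0r.
have [K K0 hK] := lip0_bound hL.
have PL : lip0 (fun u : 'M[R]_(1 + n, q) => X (E1 *m u)^T).
  apply: (lip0_lin (bounded_mull _ _)).
  apply: (lip0_lin (bounded_rscale _)); apply: (lip0_lin (bounded_mull _ _)).
  apply: (lip0_lin (bounded_tr _ _ _)); apply: (lip0_lin (bounded_mull _ _)).
  exact: lip0_id.
have [K1 K10 PK] := lip0_bound PL; have [K2 K20 CK] := lip0_bound CL.
pose M := 1 + K1 + K2.
have M0 : 0 < M by rewrite /M; lra.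
pose rho' := Num.min 1 (rho / M).
have rho'0 : 0 < rho' by rewrite lt_min ltr01 divr_gt0.
have [eps eps0 fixpt] := small_fixed_point gS rho'0.
exists (Num.min 1 (eps / (K + 1))) => [|mu].
  by rewrite lt_min ltr01 divr_gt0// ltr_wpDl.
rewrite le_min => /andP[mu1]; rewrite ler_pdivlMr ?ltr_wpDl// => mueps.
have [|u urho uE] := fixpt (- Lc (S *m diag_mx mu^T) 0).
  rewrite (le_trans (hK _ mu1))//; apply: le_trans mueps.
  by rewrite mulrC ler_wpM2l ?fnorm_ge0// lerDl.
have {uE} uE : u = - Lc (N1 u + S *m diag_mx mu^T) (N2 u).
  by rewrite {1}uE -opprD -LcD addr0.
move: urho; rewrite le_min => /andP[u1]; rewrite ler_pdivlMr// => uM.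
set f1 := N1 u + _ in uE; set f2 := N2 u in uE.
have xE : (E1 *m u)^T = - xh f1 f2.
  rewrite {1}uE /Lc mulmxN mulmxDr !mulmxA !EJ mul1mx mul0mx addr0.
  by rewrite raddfN/= trmxK.
have CE : E2 *m u = - Ch f1 f2.
  by rewrite {1}uE /Lc mulmxN mulmxDr !mulmxA !EJ mul1mx mul0mx add0r.
exists (Pd + X (E1 *m u)^T), (E2 *m u).
have u0 := fnorm_ge0 u.
have ZE : B^T *m (Pd + X (E1 *m u)^T) = Zd + ze u by rewrite mulmxDr.
have eE : rdot (Zd + ze u) (Zd + ze u) - rdot Zd Zd =
          2 *: (E1 *m u)^T + rdot (ze u) (ze u).
  rewrite rdotDl !rdotDr (rdotC (ze u) Zd) XE !addrA (ACl (1 * 5 * 2 * 3 * 4))/=.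
  by rewrite subrr add0r scaler_nat mulr2n.
pose x2 : 'cV[R]_q := 2 *: (E1 *m u)^T.
have E2u : E2 *m u = - (f1 + B *m diag_mx x2^T).
  rewrite CE /Ch /x2 xE; congr (- (_ + _)).
  have -> : diag_mx (2 *: - xh f1 f2)^T = - (2 *: diag_mx (xh f1 f2)^T).
    move: (xh f1 f2) => y; apply/matrixP => i j.
    by rewrite !mxE mulrN mulNrn mulrnAr.
  by rewrite mulmxN -scalemxAr -scalemxAl.
rewrite /= ZE eE -/x2; split.
- rewrite addrC addKr (le_trans (PK _ u1))//; apply: le_trans uM.
  by rewrite mulrC ler_wpM2l// /M; lra.
- rewrite (le_trans (CK _ u1))//; apply: le_trans uM.
  by rewrite mulrC ler_wpM2l// /M; lra.
- rewrite (_ : diag_mx (x2 + _)^T = diag_mx x2^T + diag_mx (rdot (ze u) (ze u))^T).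
    rewrite mulmxDr !addrA (ACl (1 * (2 * 4 * 5 * 3)))/= -/(N1 u) -/f1.
    by rewrite {1}E2u addNr.
  by rewrite [_^T]raddfD [diag_mx _]raddfD.
- have rhoE : rdot Zd (B^T *m (E2 *m u *m Zd)) = - f2.
    rewrite E2u mulNmx mulmxN rdotNr mulmxDl mulmxDr rdotDr -(mulmxA B) -/(rscale x2 Zd).
    rewrite HE /x2 xE scalerN mulmxN /xh -scalemxAl scalerA mulfV// scale1r.
    by rewrite (mulmxA H) HHi mul1mx opprB addrAC subrr sub0r.
  rewrite !mulmxDr !rdotDr !rdotDl rhoE -!addrA.
  rewrite /f2 /N2 !addrA.
  by rewrite -!addrA addNr.
Qed.

End Equilibrium.

(** * Derivatives of matrix-valued functions of time *)

Section MatrixDerive.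
Variable R : realType.

Lemma is_derive_mxP a b (X : R -> 'M[R]_(a, b)) (t : R) X' :
  is_derive t 1 X X' <-> forall i j, is_derive t 1 (fun s => X s i j) (X' i j).
Proof.
split=> [[dX <-] i j|dX].
  apply: DeriveDef; first by move/derivable_mxP : dX; exact.
  by rewrite derive_mx// mxE.
have dX' : derivable X t 1 by apply/derivable_mxP => i j; have [] := dX i j.
apply: DeriveDef => //; rewrite derive_mx//; apply/matrixP => i j.
by rewrite mxE; exact: derive_val.
Qed.

Lemma is_derive_sumE n (h : 'I_n -> R -> R) (t : R) (dh : 'I_n -> R) :
  (forall i, is_derive t 1 (h i) (dh i)) ->
  is_derive t 1 (fun s => \sum_i h i s) (\sum_i dh i).
Proof.
move=> dhP; rewrite (_ : (fun _ => _) = \sum_i h i); last first.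
  by apply/funext => s; rewrite fct_sumE.
exact: is_derive_sum.
Qed.

Lemma is_derive_mulE (f g : R -> R) (t f' g' : R) :
  is_derive t 1 f f' -> is_derive t 1 g g' ->
  is_derive t 1 (fun s => f s * g s) (f' * g t + f t * g').
Proof.
move=> df dg; apply: (is_derive_eq (is_deriveM df dg)).
by rewrite addrC; congr (_ + _); rewrite [LHS]mulrC.
Qed.

Lemma is_derive_mulmx a b c (X : R -> 'M[R]_(a, b)) (Y : R -> 'M[R]_(b, c)) (t : R) X' Y' :
  is_derive t 1 X X' -> is_derive t 1 Y Y' ->
  is_derive t 1 (fun s => X s *m Y s) (X' *m Y t + X t *m Y').
Proof.
move=> /is_derive_mxP dX /is_derive_mxP dY; apply/is_derive_mxP => i j.
rewrite (_ : (fun _ => _) = (fun s => \sum_k X s i k * Y s k j)); last first.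
  by apply/funext => s; rewrite mxE.
apply: (is_derive_eq (is_derive_sumE (fun k => is_derive_mulE (dX i k) (dY k j)))).
by rewrite !mxE -big_split.
Qed.

Lemma is_derive_mull a b c (A : 'M[R]_(a, b)) (Y : R -> 'M[R]_(b, c)) (t : R) Y' :
  is_derive t 1 Y Y' -> is_derive t 1 (fun s => A *m Y s) (A *m Y').
Proof.
move=> dY; apply: (is_derive_eq (is_derive_mulmx (is_derive_cst A t 1) dY)).
by rewrite mul0mx add0r.
Qed.

Lemma is_derive_mulr a b c (A : 'M[R]_(b, c)) (Y : R -> 'M[R]_(a, b)) (t : R) Y' :
  is_derive t 1 Y Y' -> is_derive t 1 (fun s => Y s *m A) (Y' *m A).
Proof.
move=> dY; apply: (is_derive_eq (is_derive_mulmx dY (is_derive_cst A t 1))).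
by rewrite mulmx0 addr0.
Qed.

Lemma is_derive_fdot a b (X Y : R -> 'M[R]_(a, b)) (t : R) X' Y' :
  is_derive t 1 X X' -> is_derive t 1 Y Y' ->
  is_derive t 1 (fun s => fdot (X s) (Y s)) (fdot X' (Y t) + fdot (X t) Y').
Proof.
move=> /is_derive_mxP dX /is_derive_mxP dY.
rewrite (_ : (fun _ => _) = (fun s => \sum_i \sum_k X s i k * Y s i k)); last first.
  by apply/funext => s; rewrite fdotE.
rewrite !fdotE -big_split/=; apply: is_derive_sumE => i.
rewrite -big_split/=; apply: is_derive_sumE => k.
exact: (is_derive_mulE (dX _ _) (dY _ _)).
Qed.

Lemma is_derive_rdot a b (X Y : R -> 'M[R]_(a, b)) (t : R) X' Y' :
  is_derive t 1 X X' -> is_derive t 1 Y Y' ->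
  is_derive t 1 (fun s => rdot (X s) (Y s)) (rdot X' (Y t) + rdot (X t) Y').
Proof.
move=> /is_derive_mxP dX /is_derive_mxP dY; apply/is_derive_mxP => i j.
rewrite (_ : (fun _ => _) = (fun s => \sum_k X s i k * Y s i k)); last first.
  by apply/funext => s; rewrite mxE.
rewrite !mxE -big_split/=; apply: is_derive_sumE => k.
exact: (is_derive_mulE (dX _ _) (dY _ _)).
Qed.

Lemma is_derive_rscale a b (e : R -> 'cV[R]_a) (Y : R -> 'M[R]_(a, b)) (t : R) e' Y' :
  is_derive t 1 e e' -> is_derive t 1 Y Y' ->
  is_derive t 1 (fun s => rscale (e s) (Y s)) (rscale e' (Y t) + rscale (e t) Y').
Proof.
move=> /is_derive_mxP de /is_derive_mxP dY; apply/is_derive_mxP => i j.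
rewrite (_ : (fun _ => _) = (fun s => e s i 0 * Y s i j)); last first.
  by apply/funext => s; rewrite rscaleE.
by rewrite mxE !rscaleE; exact: (is_derive_mulE (de _ _) (dY _ _)).
Qed.

Lemma is_derive_trmx a b (Y : R -> 'M[R]_(a, b)) (t : R) Y' :
  is_derive t 1 Y Y' -> is_derive t 1 (fun s => (Y s)^T) Y'^T.
Proof.
move=> /is_derive_mxP dY; apply/is_derive_mxP => i j.
rewrite (_ : (fun _ => _) = (fun s => Y s j i)) ?mxE//.
by apply/funext => s; rewrite mxE.
Qed.

Lemma is_derive_scalemx a b (f : R -> R) (A : 'M[R]_(a, b)) (t : R) f' :
  is_derive t 1 f f' -> is_derive t 1 (fun s => f s *: A) (f' *: A).
Proof.
move=> df; apply/is_derive_mxP => i j.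
rewrite (_ : (fun _ => _) = (fun s => f s * A i j)); last first.
  by apply/funext => s; rewrite mxE.
rewrite mxE; apply: (is_derive_eq (is_derive_mulE df (is_derive_cst (A i j) t 1))).
by rewrite mulr0 addr0.
Qed.

Lemma is_derive_unstack k m (x : R -> 'cV[R]_(k * m)) (t : R) x' :
  is_derive t 1 x x' -> is_derive t 1 (fun s => unstack (x s)) (unstack x').
Proof.
move=> /is_derive_mxP dx; apply/is_derive_mxP => i j; rewrite mxE.
rewrite (_ : (fun _ => _) = (fun s => x s (mxtens_index (i, j)) 0)); first exact: dx.
by apply/funext => s; rewrite mxE.
Qed.

Lemma is_derive_stack k m (x : R -> 'M[R]_(k, m)) (t : R) x' :
  is_derive t 1 x x' -> is_derive t 1 (fun s => stack (x s)) (stack x').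
Proof.
move=> /is_derive_mxP dx; apply/is_derive_mxP => i j; rewrite mxE.
rewrite (_ : (fun _ => _) =
   (fun s => x s (mxtens_unindex i).1 (mxtens_unindex i).2)); first exact: dx.
by apply/funext => s; rewrite mxE.
Qed.

End MatrixDerive.

(** * The exponential of a skew matrix *)

Section Rodrigues.
Variables (R : realType) (m : nat) (A : 'M[R]_m) (s : R).
Hypotheses (A_skew : A^T = - A) (A_cube : A *m A *m A = - s ^+ 2 *: A)
  (A_eq0 : s = 0 -> A = 0).

(** Rodrigues' formula for the exponential of t A. *)
Definition skew_exp (t : R) : 'M[R]_m :=
  1%:M + (sin (s * t) / s) *: A + ((1 - cos (s * t)) / s ^+ 2) *: (A *m A).

(** The integral of the exponential from 0 to t. *)
Definition skew_int (t : R) : 'M[R]_m :=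
  t%:M + ((1 - cos (s * t)) / s ^+ 2) *: A
       + ((t - sin (s * t) / s) / s ^+ 2) *: (A *m A).

Let s_eq0 : s = 0 -> forall t, skew_exp t = 1%:M.
Proof.
by move=> s0 t; rewrite /skew_exp A_eq0// mulmx0 !scaler0 !addr0.
Qed.

Lemma skew_exp0 : skew_exp 0 = 1%:M.
Proof. by rewrite /skew_exp mulr0 sin0 cos0 subrr !mul0r !scale0r !addr0. Qed.

Lemma skew_expD t u : skew_exp (t + u) = skew_exp t *m skew_exp u.
Proof.
have [s0|sN0] := eqVneq s 0; first by rewrite !s_eq0// mulmx1.
have A4 : A *m (A *m (A *m A)) = - s ^+ 2 *: (A *m A).
  by rewrite !mulmxA A_cube -scalemxAl.
rewrite /skew_exp mulrDr sinD cosD.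
move: (sin (s * t)) (cos (s * t)) (sin (s * u)) (cos (s * u)) => a b c d.
rewrite !mulmxDr !mulmxDl !mul1mx !mulmx1.
rewrite -!scalemxAr -!scalemxAl -!mulmxA A4 (mulmxA A A A) A_cube !scalerA.
apply/matrixP => i j; rewrite !mxE.
move: ((i == j)%:R) (A i j) (\sum_k _) => x y z.
by field.
Qed.

Lemma skew_exp_tr t : (skew_exp t)^T = skew_exp (- t).
Proof.
rewrite /skew_exp mulrN sinN cosN !raddfD/= trmx1 !linearZ/= trmx_mul A_skew.
by rewrite mulNmx mulmxN opprK scalerN mulNr scaleNr.
Qed.

(** The determinant is 1 because it is the square of the determinant at t / 2,
    which is 1 or -1. *)
Lemma skew_exp_rotation t : rotation (skew_exp t).
Proof.
have orth u : (skew_exp u)^T *m skew_exp u = 1%:M.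
  by rewrite skew_exp_tr -skew_expD addNr skew_exp0.
split; first exact: orth.
have detsq u : \det (skew_exp u) ^+ 2 = 1.
  by rewrite expr2 -{1}det_tr -det_mulmx orth det1.
have : t = t / 2 + t / 2 by field.
by move=> ->; rewrite skew_expD det_mulmx -expr2 detsq.
Qed.

Lemma is_derive_sin_lin (t : R) : is_derive t 1 (fun t => sin (s * t)) (s * cos (s * t)).
Proof.
have ds := is_derive_mulE (is_derive_cst s t 1) (is_derive_id t (1 : R)).
apply: (is_derive_eq (is_derive1_comp (f := sin) (g := fun u => s * u) (is_derive_sin _) ds)).
by rewrite mul0r add0r mulr1 mulrC.
Qed.

Lemma is_derive_cos_lin (t : R) : is_derive t 1 (fun t => cos (s * t)) (- (s * sin (s * t))).
Proof.
have ds := is_derive_mulE (is_derive_cst s t 1) (is_derive_id t (1 : R)).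
apply: (is_derive_eq (is_derive1_comp (f := cos) (g := fun u => s * u) (is_derive_cos _) ds)).
by rewrite mul0r add0r mulr1 mulrC mulrN.
Qed.

Let dsin (t : R) : is_derive t 1 (fun t => sin (s * t) / s) (s * cos (s * t) / s).
Proof.
apply: (is_derive_eq (is_derive_mulE (is_derive_sin_lin t) (is_derive_cst s^-1 t 1))).
by rewrite mulr0 addr0.
Qed.

Let dcos (t : R) : is_derive t 1 (fun t => (1 - cos (s * t)) / s ^+ 2)
  (s * sin (s * t) / s ^+ 2).
Proof.
apply: (is_derive_eq (is_derive_mulE (is_deriveB (is_derive_cst (1 : R) t 1) (is_derive_cos_lin t))
                         (is_derive_cst (s ^- 2) t 1))).
by rewrite mulr0 addr0 sub0r opprK.
Qed.

Let dlin (t : R) : is_derive t 1 (fun t => (t - sin (s * t) / s) / s ^+ 2)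
  ((1 - s * cos (s * t) / s) / s ^+ 2).
Proof.
apply: (is_derive_eq (is_derive_mulE (is_deriveB (is_derive_id t (1 : R)) (dsin t))
                         (is_derive_cst (s ^- 2) t 1))).
by rewrite mulr0 addr0.
Qed.

Lemma is_derive_skew_exp (t : R) : is_derive t 1 skew_exp (skew_exp t *m A).
Proof.
have [s0|sN0] := eqVneq s 0.
  rewrite (funext (s_eq0 s0)) (A_eq0 s0) mulmx0; exact: is_derive_cst.
apply: (is_derive_eq (is_deriveD (is_deriveD (is_derive_cst 1%:M t 1)
    (is_derive_scalemx A (dsin t))) (is_derive_scalemx (A *m A) (dcos t)))).
rewrite !mulmxDl mul1mx -!scalemxAl A_cube scalerA.
apply/matrixP => i j; rewrite !mxE.
move: (A i j) (\sum_k _) => x y.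
by field.
Qed.

Lemma is_derive_skew_int (t : R) : is_derive t 1 skew_int (skew_exp t).
Proof.
have did : is_derive t 1 (fun t : R => t%:M : 'M[R]_m) 1%:M.
  rewrite (_ : (fun _ => _) = fun t => t *: 1%:M); last first.
    by apply/funext => u; rewrite scalemx1.
  rewrite -[1%:M in X in is_derive _ _ _ X]scale1r.
  exact: (is_derive_scalemx 1%:M (is_derive_id t (1 : R))).
have [s0|sN0] := eqVneq s 0.
  rewrite s_eq0// (_ : skew_int = fun t => t%:M)//.
  by apply/funext => u; rewrite /skew_int A_eq0// mulmx0 !scaler0 !addr0.
apply: (is_derive_eq (is_deriveD (is_deriveD did
    (is_derive_scalemx A (dcos t))) (is_derive_scalemx (A *m A) (dlin t)))).
rewrite /skew_exp; apply/matrixP => i j; rewrite !mxE.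
move: ((i == j)%:R) (A i j) (\sum_k _) => u x y.
by field.
Qed.

End Rodrigues.

(** * Rotations *)

Section Rotations.
Variables (R : realType) (m : nat).
Implicit Types Q : 'M[R]_m.

Lemma lipschitz_fnorm_continuous (a b : nat) (W : normedModType R)
    (f : 'M[R]_(a, b) -> W) (K : R) :
  (forall x y, `|f x - f y| <= K * fnorm (x - y)) -> continuous f.
Proof.
move=> fK x; apply: (@cvgrPdist_le _ _ _ _ (nbhs_filter x) f _).2 => e e0.
set s : R := `|K| * Num.sqrt (a * b)%:R + 1.
have s0 : 0 < s by rewrite ltr_wpDl// mulr_ge0// sqrtr_ge0.
have es0 : 0 < e / s by rewrite divr_gt0.
apply/nbhs_ballP; exists (e / s) => //= y; rewrite -ball_normE /= => /ltW xy.
rewrite (le_trans (fK _ _))//.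
rewrite (le_trans (ler_wpM2r (fnorm_ge0 _) (ler_norm K)))//.
rewrite (le_trans (ler_wpM2l (normr_ge0 K) (fnorm_le_normr _)))// mulrA.
rewrite (@le_trans _ _ (s * `|x - y|))//; first by rewrite ler_wpM2r// /s lerDl.
by rewrite mulrC -ler_pdivlMr.
Qed.

Lemma rotation_mulT Q : rotation Q -> Q *m Q^T = 1%:M.
Proof. by case=> Q1 _; exact: mulmx1C. Qed.

Lemma rotation1 : rotation (1%:M : 'M[R]_m).
Proof. by split; rewrite ?det1// trmx1 mulmx1. Qed.

Lemma rotationM Q Q' : rotation Q -> rotation Q' -> rotation (Q *m Q').
Proof.
move=> [Q1 dQ] [Q'1 dQ']; split; last by rewrite det_mulmx dQ dQ' mulr1.
by rewrite trmx_mul mulmxA -(mulmxA Q'^T) Q1 mulmx1.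
Qed.

(** Compactness of closed bounded sets is transported from row vectors. *)
Lemma compact_rotation : compact (@rotation R m).
Proof.
pose f (u : 'rV[R]_(m * m)) : 'M[R]_m := vec_mx u.
have fij i j : continuous (fun u => f u i j).
  rewrite (_ : (fun _ => _) = fun u : 'rV_(m * m) => u ord0 (mxvec_index i j)).
    exact: coord_continuous.
  by apply/funext => v; rewrite /f mxE.
have fc : continuous f.
  apply: (@lipschitz_fnorm_continuous _ _ _ _ 1) => u v; rewrite mul1r.
  apply: le_trans (normr_le_fnorm _).
  rewrite [leLHS]/Num.Def.normr/= mx_normrE.
  apply/bigmax_leP; split=> //= -[i j] _; rewrite /f !mxE/=.
  by have := coord_le_normr (u - v) 0 (mxvec_index i j); rewrite !mxE.
have -> : @rotation R m = f @` [set u | rotation (f u)].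
  apply/seteqP; split=> [Q rQ|_ [u ru <-]//].
  by exists (mxvec Q); rewrite /= /f mxvecK.
apply: continuous_compact; first exact: continuous_subspaceT.
apply: bounded_closed_compact.
  exists 1; split; first exact: num_real.
  move=> M M1 u /= [ru _]; apply: le_trans (ltW M1).
  rewrite [leLHS]/Num.Def.normr/= mx_normrE; apply/bigmax_leP; split=> //= -[k l] _.
  rewrite ord1; case/mxvec_indexP: l => i j /=.
  have -> : u 0 (mxvec_index i j) = f u i j by rewrite /f mxE.
  have : \sum_l f u l j * f u l j = 1.
    have /matrixP/(_ j j) := ru; rewrite !mxE eqxx => ru1; apply: etrans ru1.
    by apply: eq_bigr => l _; rewrite [in RHS]mxE.
  rewrite (bigD1 i)//= -expr2 => sum1.
  rewrite -(@ler_pXn2r _ 2) ?nnegrE// expr1n real_normK ?num_real// -sum1 lerDl.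
  by apply: sumr_ge0 => l _; rewrite -expr2 sqr_ge0.
have -> : [set u | rotation (f u)] =
  \bigcap_(i : 'I_m) \bigcap_(j : 'I_m)
     [set u | \sum_k f u k i * f u k j = (i == j)%:R] `&`
  [set u | \det (f u) = 1].
  have entry u i j : ((f u)^T *m f u) i j = \sum_k f u k i * f u k j.
    by rewrite mxE; apply: eq_bigr => k _; rewrite [in LHS]mxE.
  apply/seteqP; split=> u /= [ru du]; split=> //.
    by move=> i _ j _ /=; rewrite -entry ru mxE.
  by apply/matrixP => i j; rewrite entry mxE; exact: (ru i I j I).
have closed_level (g : 'rV[R]_(m * m) -> R) c : continuous g ->
    closed [set u | g u = c].
  move=> /continuous_closedP gc.
  exact: (gc [set x | x = c] (@closed_eq R c)).
apply: closedI; last first.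
  apply: closed_level; apply: continuous_big; first exact: add_continuous.
  move=> s _.
  have cp : continuous (fun u => \prod_i f u i (s i)).
    by apply: continuous_big => [|i _]; [exact: mul_continuous|exact: fij].
  move=> u; apply: (@continuousM R _ (fun=> (-1) ^+ s) _ u _ (cp u)).
  exact: cst_continuous.
apply: closed_bigI => i _; apply: closed_bigI => j _; apply: closed_level.
apply: continuous_big; first exact: add_continuous.
by move=> k _ u; exact: (continuousM (fij k i u) (fij k j u)).
Qed.

(** The last property is the first order condition at a nearest rotated copy,
    along the one-parameter groups of rotations: since Zs is orthogonal to its
    own infinitesimal rotations, it says that the difference Z Q - Zs is. *)
Lemma nearest_rotation (q : nat) (Z Zs : 'M[R]_(q, m)) :
  m = 2%N \/ m = 3%N ->
  exists Q, [/\ rotation Q,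
    forall Q', rotation Q' -> fnorm (Z - Zs *m Q^T) <= fnorm (Z - Zs *m Q'^T) &
    forall w, fdot (Z *m Q) (Zs *m (cross_mx m w)^T) = 0].
Proof.
move=> m23.
have fc : continuous (fun Q : 'M[R]_m => fnorm (Z - Zs *m Q^T)).
  apply: (@lipschitz_fnorm_continuous _ _ _ _ (fnorm Zs)) => Q Q'.
  rewrite (le_trans (fnorm_dist _ _))// opprB addrC addrA subrK.
  rewrite -mulmxBr (le_trans (fnorm_mul _ _))// ler_wpM2l ?fnorm_ge0//.
  by rewrite -raddfB fnorm_tr fnormBC.
have [|Q] := compact_EVT_min _ compact_rotation (continuous_subspaceT fc).
  by exists 1%:M; exact: rotation1.
rewrite inE => rQ Qmin; exists Q; split=> // [Q' rQ'|w].
  by apply: Qmin; rewrite inE.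
have [s cube s0] := cross_mx_cube w m23.
pose E := skew_exp (cross_mx m w) s.
pose phi t := fdot (Z *m Q) (Zs *m (E t)^T).
have dphi (t : R) : is_derive t 1 phi (fdot (Z *m Q) (Zs *m (E t *m cross_mx m w)^T)).
  have dE := is_derive_skew_exp cube s0 t.
  apply: (is_derive_eq (is_derive_fdot (is_derive_cst (Z *m Q) t 1)
    (is_derive_mull Zs (is_derive_trmx dE)))).
  by rewrite fdot0l add0r.
have phimax t : phi t <= phi 0.
  have := Qmin (Q *m E t); rewrite inE => /(_ (rotationM rQ _)).
  have Et := skew_exp_rotation (cross_mxT m w) cube s0 t.
  move=> /(_ Et); rewrite -(@ler_pXn2r _ 2) ?nnegrE ?fnorm_ge0// !fnormsq.
  rewrite !(fdotBl, fdotBr) !(fdotC _ Z).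
  have orthE U : rotation U -> fdot (Zs *m U^T) (Zs *m U^T) = fdot Zs Zs.
    by move=> [U1 _]; rewrite fdot_mulr trmxK -mulmxA U1 mulmx1.
  rewrite !orthE//; last exact: rotationM.
  have phiE u : phi u = fdot Z (Zs *m (Q *m E u)^T).
    by rewrite /phi fdot_mulr trmx_mul mulmxA.
  by rewrite !phiE /E skew_exp0 mulmx1 -/E; lra.
have d0 : is_derive (0 : R) 1 phi 0.
  apply: (@derive1_at_max _ phi (-1) 1 0) => //.
  by rewrite in_itv/= ltrN10 ltr01.
have := @derive_val _ _ _ _ _ _ _ (dphi 0).
rewrite (@derive_val _ _ _ _ _ _ _ d0) => /esym.
by rewrite /E skew_exp0 mul1mx.
Qed.

End Rotations.

(** * Local rigidity *)

(** A linear map vanishing on the kernel of another factors through it. *)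
Lemma ker_bound (R : realType) (a b c d c' d' : nat)
    (f : 'M[R]_(a, b) -> 'M[R]_(c, d)) (g : 'M[R]_(a, b) -> 'M[R]_(c', d')) :
  linear f -> linear g -> (forall X, f X = 0 -> g X = 0) ->
  exists2 K, 0 <= K & forall X, fnorm (g X) <= K * fnorm (f X).
Proof.
move=> fl gl fg0.
pose f' : {linear 'M[R]_(a, b) -> 'M[R]_(c, d)} :=
  HB.pack f (GRing.isLinear.Build _ _ _ _ f fl).
pose g' : {linear 'M[R]_(a, b) -> 'M[R]_(c', d')} :=
  HB.pack g (GRing.isLinear.Build _ _ _ _ g gl).
have fnorm_mxvec k l (X : 'M[R]_(k, l)) : fnorm (mxvec X) = fnorm X.
  rewrite /fnorm !fdotE big_ord1 pair_big/=.
  rewrite (reindex _ (curry_mxvec_bij k l))/=; congr Num.sqrt.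
  by apply: eq_bigr => -[i j] _; rewrite /= mxvecE.
pose F := lin_mx f'; pose K := lin_mx g'.
have FK : F *m pinvmx F *m K = K.
  apply/eqP; rewrite -subr_eq0 -[X in _ - X]mul1mx -mulmxBl; apply/eqP.
  apply/row_matrixP => i; rewrite row0 row_mul.
  set r := row i _.
  have rE : r = mxvec (vec_mx r) by rewrite vec_mxK.
  rewrite rE mul_vec_lin/= fg0 ?linear0//.
  have : r *m F = 0.
    by rewrite /r -row_mul mulmxBl mul1mx mulmxKpV ?submx_refl// subrr row0.
  rewrite rE mul_vec_lin/= -/f' => /(congr1 vec_mx).
  by rewrite mxvecK vec_mxK linear0.
exists (fnorm (pinvmx F *m K)) => [|X]; first exact: fnorm_ge0.
rewrite -(fnorm_mxvec _ _ (g X)) -(fnorm_mxvec _ _ (f X)).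
rewrite -(mul_vec_lin f' X) -(mul_vec_lin g' X) -/F -/K.
rewrite -{1}FK mulrC -!mulmxA (mulmxA (mxvec X)); exact: fnorm_mul.
Qed.

Section Alignment.
Variables (R : realType) (n m q : nat) (G : sensing_graph n q).
Variable (pd : 'cV[R]_(n * m)).
Hypotheses (n2 : (2 <= n)%N) (m23 : m = 2%N \/ m = 3%N) (rigid : inf_min_rigid G pd).
Let B := incidence R G.
Let Zd := B^T *m unstack pd.

Let Om (j : 'I_3) : 'M[R]_m := (cross_mx m (delta_mx j 0))^T.

Let cross_sum w : (cross_mx m w)^T = \sum_j w j 0 *: Om j.
Proof.
rewrite {1}[w]matrix_sum_delta (eq_bigr (fun j => w j 0 *: delta_mx j 0)).
  by rewrite !linear_sum/=; apply: eq_bigr => j _; rewrite !linearZ.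
by move=> j _; rewrite big_ord1.
Qed.

(** Relative displacements that preserve the lengths of all edges to first order
    are infinitesimal rotations of Zd, which the inner products detect. *)
Lemma rigid_coercive : exists2 K : R, 0 <= K & forall X : 'M[R]_(n, m),
  fnorm (B^T *m X) <= K * (fnorm (rdot Zd (B^T *m X)) +
    \sum_j `|fdot (B^T *m X) (Zd *m Om j)|).
Proof.
pose f (X : 'M[R]_(n, m)) : 'cV[R]_(q + 3) :=
  col_mx (rdot Zd (B^T *m X)) (\col_j fdot (B^T *m X) (Zd *m Om j)).
have fl : linear f.
  move=> c X Y; rewrite /f linearP/= rdotDr rdotZr scale_col_mx add_col_mx.
  congr col_mx; apply/colP => j; rewrite !mxE -!/(fdot _ _).
  by rewrite fdotDl fdotZl.
have gl : linear (mulmx B^T : 'M[R]_(n, m) -> _) by move=> c X Y; rewrite linearP.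
have [X fX0|K K0 HK] := ker_bound fl gl.
  have := fX0; rewrite -[0]vsubmxK => /eq_col_mx; rewrite !linear0 => -[r0 s0].
  have [q0|[w [v XE]]] := ker_rigidity n2 m23 rigid r0.
    by apply/matrixP => -[i Hi]; exfalso; move: Hi; rewrite q0.
  apply: fdot_eq0; rewrite {2}XE incidenceT_rigid_motion -/Zd cross_sum.
  rewrite mulmx_sumr (big_morph _ (fun x y => fdotDr x y _) (fdot0r _)) big1// => j _.
  rewrite -scalemxAr fdotZr; have /colP/(_ j) := s0.
  by rewrite !mxE -/(fdot _ _) => ->; rewrite mulr0.
exists K => // X; rewrite (le_trans (HK X))// ler_wpM2l// /f.
set u := rdot _ _; set v := \col_j _.
have S0 : 0 <= \sum_j `|v j 0| by rewrite sumr_ge0.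
have vS : fnorm v <= \sum_j `|v j 0|.
  rewrite -(@ler_pXn2r _ 2) ?nnegrE ?fnorm_ge0// fnormsq fdotE expr2 mulr_suml.
  apply: ler_sum => j _; rewrite big_ord1 -expr2 -real_normK ?num_real// expr2.
  by rewrite ler_wpM2l// (bigD1 j)//= lerDl sumr_ge0.
have -> : \sum_j `|fdot (B^T *m X) (Zd *m Om j)| = \sum_j `|v j 0|.
  by apply: eq_bigr => j _; rewrite mxE.
apply: (@le_trans _ _ (fnorm u + fnorm v)); last by rewrite lerD2l.
rewrite -(@ler_pXn2r _ 2) ?nnegrE ?addr_ge0 ?fnorm_ge0// fnormsq.
rewrite fdotE big_split_ord/=.
under eq_bigr do rewrite big_ord1 !col_mxEu.
under [X in _ + X <= _]eq_bigr do rewrite big_ord1 !col_mxEd.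
have cE k (y : 'cV[R]_k) : fnorm y ^+ 2 = \sum_i y i 0 * y i 0.
  by rewrite fnormsq fdotE; apply: eq_bigr => i _; rewrite big_ord1.
rewrite -!cE; have := fnorm_ge0 u; have := fnorm_ge0 v; nra.
Qed.

(** For a nearest rotated copy the difference D is orthogonal to the
    infinitesimal rotations of Zs, hence bounded by its first order effect
    2 rdot Zs D on the squared edge lengths.  This effect differs from the actual
    change by rdot D D, which is absorbed as D is small. *)
Lemma alignment : exists rho delta K : R, [/\ 0 < rho, 0 < delta, 0 <= K &
  forall (P Ps : 'M[R]_(n, m)) (Q : 'M[R]_m),
    let Z := B^T *m P in let Zs := B^T *m Ps in
    fnorm (Zs - Zd) <= rho -> rotation Q -> fnorm (Z - Zs *m Q^T) <= delta ->
    exists2 Q', rotation Q' &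
      fnorm (Z - Zs *m Q'^T) <= K * fnorm (rdot Z Z - rdot Zs Zs)].
Proof.
have [K K0 HK] := rigid_coercive.
pose om : R := 1 + \sum_j fnorm (Om j).
have om1 : 1 <= om by rewrite lerDl sumr_ge0// => j _; exact: fnorm_ge0.
have om0 : 0 < om by rewrite (lt_le_trans _ om1).
have K10 : 0 < K + 1 by rewrite ltr_wpDl.
exists ((2 * (K + 1) * om)^-1), ((4 * (K + 1))^-1), (4 * K); split.
- by rewrite invr_gt0 !mulr_gt0.
- by rewrite invr_gt0 !mulr_gt0.
- by rewrite mulr_ge0.
move=> P Ps Q Z Zs Zrho rQ ZQ.
have [Q' [rQ' Qmin crit]] := nearest_rotation Z Zs m23.
exists Q' => //.
pose D := Z *m Q' - Zs.
have DE : fnorm (Z - Zs *m Q'^T) = fnorm D.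
  rewrite -[LHS](fnorm_orth _ (rotation_mulT rQ')) mulmxBl -(mulmxA Zs).
  by case: rQ' => -> _; rewrite mulmx1.
have Ddelta : fnorm D <= (4 * (K + 1))^-1.
  by rewrite -DE (le_trans (Qmin _ rQ)).
have DX : D = B^T *m (P *m Q' - Ps) by rewrite mulmxBr mulmxA.
have Dorth j : fdot D (Zs *m Om j) = 0.
  rewrite /D fdotBl crit sub0r; apply/eqP; rewrite oppr_eq0; apply/eqP.
  have := fdot_rdot (const_mx 1) Zs (Zs *m Om j).
  rewrite rdot_cross fdot0r => /esym; rewrite /rscale.
  by rewrite (_ : diag_mx _ = 1%:M) ?mul1mx//; apply/matrixP => k l; rewrite !mxE.
have D0 := fnorm_ge0 D; have e0 := fnorm_ge0 (Zs - Zd).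
have rdD : fnorm (rdot Zd D) <= fnorm (rdot Zs D) + fnorm (Zs - Zd) * fnorm D.
  rewrite (_ : rdot Zd D = rdot Zs D - rdot (Zs - Zd) D).
    by rewrite (le_trans (fnormB _ _))// lerD2l fnorm_rdot.
  by rewrite rdotBl opprB addrC subrK.
have sD : \sum_j `|fdot D (Zd *m Om j)| <=
    fnorm (Zs - Zd) * fnorm D * \sum_j fnorm (Om j).
  rewrite mulr_sumr; apply: ler_sum => j _.
  rewrite (_ : fdot D _ = - fdot D ((Zs - Zd) *m Om j)); last first.
    by rewrite mulmxBl fdotBr Dorth sub0r opprK.
  rewrite normrN (le_trans (fdot_CS _ _))// (mulrC _ (fnorm D)) -mulrA.
  by rewrite ler_wpM2l// fnorm_mul.
have := HK (P *m Q' - Ps); rewrite -DX => {}HK.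
have coer : fnorm D <= 2 * K * fnorm (rdot Zs D).
  have : fnorm D <= K * fnorm (rdot Zs D) + K * om * fnorm (Zs - Zd) * fnorm D.
    rewrite (le_trans HK)// -!mulrA -mulrDr ler_wpM2l// /om.
    by move: rdD sD; move: (\sum_j fnorm _) => S; nra.
  have : K * om * fnorm (Zs - Zd) <= 2^-1.
    move: Zrho; rewrite -[(_)^-1]mul1r ler_pdivlMr ?mulr_gt0//.
    have : 0 <= om * fnorm (Zs - Zd) by rewrite mulr_ge0// ltW.
    by move: (fnorm _) => x; nra.
  by nra.
have quad : 2 *: rdot Zs D = rdot Z Z - rdot Zs Zs - rdot D D.
  rewrite -(rdot_orth Z Z (rotation_mulT rQ')).
  rewrite (_ : Z *m Q' = Zs + D); last by rewrite /D addrC subrK.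
  move: D {DE Ddelta DX Dorth D0 rdD sD HK coer} => D;
    rewrite rdotDl !rdotDr (rdotC D Zs) scaler_nat mulr2n !addrA.
  by rewrite [RHS](ACl (2 * 3 * (1 * 5) * (4 * 6)))/= !subrr !addr0.
have : 2 * fnorm (rdot Zs D) <= fnorm (rdot Z Z - rdot Zs Zs) + fnorm D ^+ 2.
  rewrite -[2 in X in X <= _](ger0_norm (ler0n R 2)) -fnormZ quad.
  by rewrite (le_trans (fnormB _ _))// lerD2l expr2 fnorm_rdot.
move=> /(ler_wpM2l K0) quadK; rewrite DE; move: Ddelta.
rewrite -[(_)^-1]mul1r ler_pdivlMr ?mulr_gt0// => Ddelta.
have Kd : K * fnorm D <= 4^-1 by lra.
have := ler_wpM2r D0 Kd.
have : 0 <= K * fnorm (rdot Z Z - rdot Zs Zs) by rewrite mulr_ge0// fnorm_ge0.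
by lra.
Qed.

End Alignment.

(** * Stresses of a minimally rigid framework *)

Section Stress.
Variables (R : realType) (n m q : nat) (G : sensing_graph n q).
Let B := incidence R G.

Lemma rigidity_mxT (p : 'cV[R]_(n * m)) (e : 'cV[R]_q) :
  unstack ((rigidity_mx G (relpos G p))^T *m e) = B *m rscale e (B^T *m unstack p).
Proof.
rewrite /rigidity_mx trmx_mul !trmxK -mulmxA unstack_bar unstack_blkdiag.
by rewrite unstack_barT.
Qed.

(** Minimality makes the rows of the rigidity matrix independent. *)
Lemma stress_free (p : 'cV[R]_(n * m)) (e : 'cV[R]_q) :
  inf_min_rigid G p -> B *m rscale e (B^T *m unstack p) = 0 -> e = 0.
Proof.
move=> [rk qE] e0; apply: trmx_inj; rewrite trmx0; apply/eqP.
have free : row_free (rigidity_mx G (relpos G p)).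
  by rewrite /row_free rk -qE.
rewrite -(mulmx_free_eq0 _ free) -trmx_eq0 trmx_mul trmxK.
by rewrite -[_ *m _](@unstackK R) rigidity_mxT e0; apply/eqP/colP => i; rewrite !mxE.
Qed.

Lemma stress_free_rigid (p : 'cV[R]_(n * m)) : q = rigid_rank n m ->
  (forall e, B *m rscale e (B^T *m unstack p) = 0 -> e = 0) -> inf_min_rigid G p.
Proof.
move=> qE inj; split=> //; rewrite /inf_rigid -qE; apply/eqP.
rewrite -/(row_free _) -kermx_eq0; apply/rowV0P => u /sub_kermxP u0.
apply: trmx_inj; rewrite trmx0; apply: inj; rewrite -rigidity_mxT.
by rewrite -trmx_mul u0; apply/matrixP => i j; rewrite !mxE.
Qed.

(** H is the Gram matrix of the rows of the rigidity matrix, which are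
    independent. *)
Lemma rigidity_gram (p : 'cV[R]_(n * m)) : inf_min_rigid G p ->
  let Z := B^T *m unstack p in
  exists H Hi : 'M[R]_q,
    (forall x, rdot Z (B^T *m (B *m rscale x Z)) = H *m x) /\ H *m Hi = 1%:M.
Proof.
move=> rigid Z; pose Rm := rigidity_mx G (relpos G p).
have HE x : rdot Z (B^T *m (B *m rscale x Z)) = Rm *m Rm^T *m x.
  by rewrite -mulmxA rigidity_mxE rigidity_mxT.
exists (Rm *m Rm^T), (invmx (Rm *m Rm^T)); split=> //.
apply: mulmxV; rewrite -row_free_unit -kermx_eq0.
apply/rowV0P => u /sub_kermxP u0.
apply: trmx_inj; rewrite trmx0; apply: (stress_free rigid); apply: fdot_eq0.
rewrite fdot_mull -fdot_rdot HE.
have -> : Rm *m Rm^T *m u^T = (u *m (Rm *m Rm^T))^T by rewrite !trmx_mul !trmxK.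
by rewrite u0 trmx0 fdot0r.
Qed.

Lemma stress_coercive (p : 'cV[R]_(n * m)) : inf_min_rigid G p ->
  exists c rho : R, [/\ 0 < c, 0 < rho & forall Z,
    fnorm (Z - B^T *m unstack p) <= rho ->
    forall e, c * fnorm e <= fnorm (B *m rscale e Z)].
Proof.
move=> rigid; pose Zd := B^T *m unstack p.
have fl : linear (fun e => B *m rscale e Zd).
  by move=> a x y; rewrite /rscale !linearP/= mulmxDl -scalemxAl mulmxDr -scalemxAr.
have gl : linear (id : 'cV[R]_q -> _) by [].
have [X X0|K K0 HK] := ker_bound fl gl; first exact: (stress_free rigid).
have K1 : 0 < 2 * (K + 1) by lra.
have b0 := fnorm_ge0 B; have b1 : 0 < fnorm B + 1 by lra.
exists (2 * (K + 1))^-1, (2 * (K + 1) * (fnorm B + 1))^-1.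
have KB0 : 0 < 2 * (K + 1) * (fnorm B + 1) by rewrite mulr_gt0.
split; rewrite ?invr_gt0// => Z.
rewrite -[leRHS]mul1r ler_pdivlMr// => Zr e.
rewrite mulrC ler_pdivrMr// mulrC.
have := HK e; have := fnorm_ge0 e.
have : fnorm (B *m rscale e Zd) <=
    fnorm (B *m rscale e Z) + fnorm B * (fnorm e * fnorm (Z - Zd)).
  rewrite (_ : B *m rscale e Zd = B *m rscale e Z - B *m rscale e (Z - Zd)).
    rewrite (le_trans (fnormB _ _))// lerD2l (le_trans (fnorm_mul _ _))//.
    by rewrite ler_wpM2l// fnorm_rscale.
  by rewrite -mulmxBr -rscaleBr opprB addrC subrK.
rewrite -/Zd in Zr; move: Zr (fnorm_ge0 (Z - Zd)) (fnorm_ge0 (B *m rscale e Z)).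
set d := fnorm (Z - Zd); set f := fnorm (B *m rscale e Z).
set f' := fnorm (B *m rscale e Zd); set x := fnorm e; set b := fnorm B.
move=> dK d0 f0 f'f x0 xK.
have H1 : K * f' <= K * (f + b * (x * d)) by rewrite ler_wpM2l.
have H2 : 2 * (K * b * d) <= 1.
  have : 0 <= d * b by rewrite mulr_ge0.
  have : 0 <= d * K by rewrite mulr_ge0.
  by lra.
have H3 := ler_wpM2l x0 H2.
by have := mulr_ge0 K0 f0; lra.
Qed.

End Stress.

(** * The Lyapunov function *)

Section Lyapunov.
Variable R : realType.

Lemma derive_le0_nincr (f f' : R -> R) (a b : R) : a <= b ->
  (forall t, a <= t <= b -> is_derive t 1 f (f' t)) ->
  (forall t, a <= t <= b -> f' t <= 0) -> f b <= f a.
Proof.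
move=> ab df f'0.
have sub t : t \in `]a, b[%R -> a <= t <= b.
  by rewrite in_itv/= => /andP[/ltW -> /ltW ->].
have der t : t \in `]a, b[%R -> derivable f t 1 by move=> /sub/df[].
apply: (@ler0_derive1_le_cc R f a b der) => //.
- move=> t /sub tab; rewrite derive1E (@derive_val _ _ _ _ _ _ _ (df _ tab)).
  exact: f'0.
- apply: derivable_within_continuous => t.
  by rewrite in_itv/= => /df[].
- by rewrite in_itv/= ab lexx.
- by rewrite in_itv/= lexx ab.
Qed.

Lemma is_derive_expR_lin (c t : R) :
  is_derive t 1 (fun s => expR (c * s)) (c * expR (c * t)).
Proof.
have ds := is_derive_mulE (is_derive_cst c t 1) (is_derive_id t (1 : R)).
apply: (is_derive_eq (is_derive1_comp (f := expR) (g := fun u => c * u)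
  (is_derive_expR _) ds)).
by rewrite mul0r add0r mulr1 mulrC.
Qed.

Lemma exp_decay (f f' : R -> R) (g a b : R) : a <= b ->
  (forall t, a <= t <= b -> is_derive t 1 f (f' t)) ->
  (forall t, a <= t <= b -> f' t <= - g * f t) ->
  f b <= f a * expR (- g * (b - a)).
Proof.
move=> ab df f'g.
have := @derive_le0_nincr (fun t => f t * expR (g * t))
  (fun t => f' t * expR (g * t) + f t * (g * expR (g * t))) a b ab.
move=> /(_ (fun t h => is_derive_mulE (df t h) (is_derive_expR_lin g t))) H.
have {H} : f b * expR (g * b) <= f a * expR (g * a).
  apply: H => t tab; rewrite mulrA -mulrDl pmulr_lle0 ?expR_gt0//.
  by have := f'g t tab; lra.
rewrite -ler_pdivlMr ?expR_gt0// -expRN -mulrA -expRD.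
by rewrite (_ : g * a + - (g * b) = - g * (b - a))//; ring.
Qed.

(** Let tau be the infimum of the times at which the bound d fails.  The bound
    d / 2 holds at times arbitrarily close to tau from the left, or at t0, so by
    continuity the bound d holds for a while after tau. *)
Lemma trapped (k m : nat) (X : R -> 'M[R]_(k, m)) (O : set 'M[R]_(k, m))
    (d t0 : R) :
  let near e t := exists2 U, O U & fnorm (X t - U) <= e in
  0 < d -> (forall t, t0 <= t -> {for t, continuous X}) ->
  near (d / 2) t0 ->
  (forall t, t0 <= t -> (forall s, t0 <= s <= t -> near d s) -> near (d / 2) t) ->
  forall t, t0 <= t -> near d t.
Proof.
move=> near d0 Xc near0 improve t tt0; apply: contrapT => nt.
pose A := [set s | t0 <= s /\ ~ near d s].
have At : A t by [].
have hiA : has_inf A by split; [exists t|exists t0 => s []].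
pose tau := inf A.
have t0tau : t0 <= tau by apply: lb_le_inf; [exists t|move=> s []].
have before s : t0 <= s -> s < tau -> near d s.
  move=> ts stau; apply: contrapT => ns.
  by have : tau <= s; [apply: ge_inf => //; exact: hiA.2|rewrite leNgt stau].
have halfbefore s : t0 <= s -> s < tau -> near (d / 2) s.
  move=> ts stau; apply: improve => // u /andP[tu us].
  by apply: before => //; exact: le_lt_trans stau.
have s1 : 0 < Num.sqrt (k * m)%:R + 1 :> R by rewrite ltr_wpDl// sqrtr_ge0.
have d4 : 0 < d / 4 / (Num.sqrt (k * m)%:R + 1) by rewrite !divr_gt0.
have /cvgrPdist_le/(_ _ d4) := Xc _ t0tau.
move=> /nbhs_ballP[e /= e0 He].
have close s : `|tau - s| < e -> fnorm (X tau - X s) <= d / 4.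
  move=> se; have := He s se; rewrite ler_pdivlMr// => H.
  rewrite (le_trans (fnorm_le_normr _))//; apply: le_trans H.
  by rewrite mulrC ler_wpM2l// lerDl.
have [u uclose [U OU Uu]] : exists2 u, `|tau - u| < e & near (d / 2) u.
  have [t0E|tN] := eqVneq t0 tau; first by exists t0; rewrite ?t0E ?subrr ?normr0 -?t0E.
  have t0lt : t0 < tau by rewrite lt_neqAle tN.
  exists (Num.max t0 (tau - e / 2)).
    rewrite ger0_norm ?subr_ge0 ?ge_max ?t0tau/=; last by rewrite gerBl ltW// divr_gt0.
    rewrite ltrBlDr -ltrBlDl lt_max; apply/orP; right.
    by rewrite ltrD2l ltrN2; lra.
  apply: halfbefore; first by rewrite le_max lexx.
  by rewrite gt_max t0lt/= gtrBl divr_gt0.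
have [s As stau] : exists2 s, A s & s < tau + e by exact: inf_adherent.
have tausx : tau <= s by apply: ge_inf => //; exact: hiA.2.
case: As => _; apply; exists U => //.
have sclose : `|tau - s| < e by rewrite distrC ger0_norm ?subr_ge0// ltrBlDl.
have -> : X s - U = - (X tau - X s) + ((X tau - X u) + (X u - U)).
  by rewrite (addrA (X tau - X u)) subrK opprB addrA subrK.
rewrite (le_trans (fnormD _ _))// fnormN.
have := fnormD (X tau - X u) (X u - U).
by have := close _ sclose; have := close _ uclose; lra.
Qed.

(** The derivative of the energy controls only the velocity; the cross term,
    with a small coefficient b, adds control of the error.  Here kap bounds C, a
    and y are the norms of the error and of the velocity deviation, nn is the
    norm of the force B diag(E) Z, and the other letters stand for the inner
    products that occur in the derivative. *)
Lemma lyapunov_scalars (M c : R) : 1 <= M -> 0 < c ->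
  exists b k g : R, [/\ 0 < b, 0 < k <= 1, 0 < g, b * M ^+ 2 <= 2^-1 &
  forall kap a y nn EG YCY NY N'Y NCY : R, 0 <= kap <= k -> 0 <= a -> 0 <= y ->
    EG <= kap * M * a ^+ 2 -> - YCY <= kap * M * y ^+ 2 ->
    `|NY| <= M ^+ 2 * (a * y) -> N'Y <= 3 * M ^+ 4 * (y + a) * y ->
    - NCY <= M ^+ 3 * (a * y) -> c * a <= nn ->
    2 * (NY + EG) + 2 * (- y ^+ 2 - NY - YCY)
      + b * (N'Y + (- NY - nn ^+ 2 - NCY))
    <= - g * (2^-1 * a ^+ 2 + y ^+ 2 + b * NY)].
Proof.
move=> M1 c0.
have M0 : 0 < M by lra.
have M10 i : 1 <= M ^+ i by rewrite exprn_ege1.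
pose L := 5 * M ^+ 4.
have L0 : 0 < L by rewrite mulr_gt0// exprn_gt0.
have c20 : 0 < c ^+ 2 by rewrite exprn_gt0.
pose D := L + L ^+ 2 / (2 * c ^+ 2).
have D0 : 0 < D by rewrite addr_gt0// divr_gt0 ?mulr_gt0 ?exprn_gt0.
pose b := Num.min (2^-1 / D) (2^-1 / M ^+ 2).
have b0 : 0 < b by rewrite lt_min !divr_gt0 ?exprn_gt0.
have bD : b * D <= 2^-1 by rewrite -ler_pdivlMr// /b ge_min lexx.
have bM : b * M ^+ 2 <= 2^-1 by rewrite -ler_pdivlMr ?exprn_gt0// /b ge_min lexx orbT.
pose k := Num.min 1 (Num.min (4^-1 / M) (b * c ^+ 2 / 8 / M)).
have k0 : 0 < k by rewrite !lt_min ltr01 !divr_gt0// mulr_gt0.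
have kM1 : k * M <= 4^-1 by rewrite -ler_pdivlMr// /k !ge_min lexx orbT.
have kM2 : k * M <= b * c ^+ 2 / 8 by rewrite -ler_pdivlMr// /k !ge_min lexx !orbT.
pose g := Num.min 2^-1 (b * c ^+ 2 / 4).
have g0 : 0 < g by rewrite lt_min invr_gt0 ltr0n divr_gt0// mulr_gt0.
have g1 : g <= 2^-1 by rewrite /g ge_min lexx.
have g2 : g <= b * c ^+ 2 / 4 by rewrite /g ge_min lexx orbT.
exists b, k, g; split=> //; first by rewrite k0 /k ge_min lexx.
move=> kap a y nn EG YCY NY N'Y NCY /andP[kap0 kapk] a0 y0 hEG hY hNY hN' hNC hnn.
have kapM1 : kap * M <= 4^-1 by rewrite (le_trans _ kM1)// ler_wpM2r// ltW.
have kapM2 : kap * M <= b * c ^+ 2 / 8 by rewrite (le_trans _ kM2)// ler_wpM2r// ltW.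
have ay0 : 0 <= a * y by rewrite mulr_ge0.
have a20 : 0 <= a ^+ 2 by rewrite sqr_ge0.
have y20 : 0 <= y ^+ 2 by rewrite sqr_ge0.
have nn2 : c ^+ 2 * a ^+ 2 <= nn ^+ 2.
  have ca0 : 0 <= c * a by rewrite mulr_ge0// ltW.
  by rewrite -exprMn lerXn2r ?nnegrE// (le_trans ca0).
have M24 : M ^+ 2 <= M ^+ 4 by rewrite ler_weXn2l.
have M34 : M ^+ 3 <= M ^+ 4 by rewrite ler_weXn2l.
(* Young's inequality for the mixed terms *)
have young : L * (a * y) <= c ^+ 2 / 2 * a ^+ 2 + L ^+ 2 / (2 * c ^+ 2) * y ^+ 2.
  have : 0 <= (c * a - L / c * y) ^+ 2 / 2 by rewrite divr_ge0 ?sqr_ge0.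
  have -> : (c * a - L / c * y) ^+ 2 / 2 = c ^+ 2 / 2 * a ^+ 2 +
     L ^+ 2 / (2 * c ^+ 2) * y ^+ 2 - L * (a * y).
    by field; rewrite gt_eqF.
  by rewrite subr_ge0.
have mixed : N'Y + (- NY - nn ^+ 2 - NCY) <= D * y ^+ 2 - c ^+ 2 / 2 * a ^+ 2.
  have H1 : - NY <= M ^+ 4 * (a * y).
    by apply: le_trans (ler_wpM2r ay0 M24); apply: le_trans hNY; rewrite -normrN ler_norm.
  have H2 : - NCY <= M ^+ 4 * (a * y) by apply: le_trans hNC _; rewrite ler_wpM2r.
  have H3 : 3 * M ^+ 4 * y ^+ 2 <= L * y ^+ 2.
    by rewrite ler_wpM2r// /L ler_wpM2r ?exprn_ge0 ?ler_nat// ltW.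
  by move: young H1 H2 H3 hN' nn2; rewrite /D /L; lra.
have {mixed} := ler_wpM2l (ltW b0) mixed.
have bD' := ler_wpM2r y20 bD.
have k1 := ler_wpM2r y20 kapM1; have k2 := ler_wpM2r a20 kapM2.
have NYb : `|b * NY| <= 2^-1 * (a * y).
  rewrite normrM (gtr0_norm b0) (le_trans (ler_wpM2l (ltW b0) hNY))// (mulrA b).
  by rewrite ler_wpM2r.
have gNY : g * (b * NY) <= g * (2^-1 * (a * y)).
  by rewrite ler_wpM2l ?(ltW g0)//; apply: le_trans NYb; exact: ler_norm.
have ga := ler_wpM2r a20 g2; have gy := ler_wpM2r y20 g1.
have gay : g * (2 * (a * y)) <= g * (a ^+ 2 + y ^+ 2).
  by rewrite ler_wpM2l ?(ltW g0)//; have := sqr_ge0 (a - y); lra.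
have gay1 : 0 <= g * y ^+ 2 by rewrite mulr_ge0// ltW.
have gay2 : 0 <= g * a ^+ 2 by rewrite mulr_ge0// ltW.
by lra.
Qed.

End Lyapunov.

(** * The dynamics relative to the steady motion *)

Section ErrorDynamics.
Variables (R : realType) (n m q : nat) (B S C : 'M[R]_(n, q)) (mu : 'cV[R]_q).
Variables (Zs Zd : 'M[R]_(q, m)).

Definition acceleration (Z : 'M[R]_(q, m)) (V : 'M[R]_(n, m)) : 'M[R]_(n, m) :=
  - V - B *m rscale (rdot Z Z - rdot Zd Zd) Z - S *m rscale mu Z.

(** By the first equation the velocities C Z obey the equations of motion as long
    as the error is that of Zs; by the second they do not change this error at
    Zs. *)
Definition stationary : Prop :=
  C + C *m B^T *m C + B *m diag_mx (rdot Zs Zs - rdot Zd Zd)^T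
    + S *m diag_mx mu^T = 0 /\ rdot Zs (B^T *m (C *m Zs)) = 0.

Definition err (Z : 'M[R]_(q, m)) : 'cV[R]_q := rdot Z Z - rdot Zs Zs.

(** The quadratic equation absorbs the mismatches and the steady error, so that
    only the deviations from the steady motion remain. *)
Lemma acceleration_shift Z V : stationary ->
  acceleration Z V - C *m (B^T *m V) =
  - (V - C *m Z) - B *m rscale (err Z) Z - C *m (B^T *m (V - C *m Z)).
Proof.
move=> [/(congr1 (fun X => X *m Z)) + _]; rewrite mul0mx !mulmxDl -!mulmxA.
rewrite -/(rscale _ _) -/(rscale mu Z) => quad.
rewrite /acceleration (_ : rdot Z Z - rdot Zd Zd =
   err Z + (rdot Zs Zs - rdot Zd Zd)); last by rewrite /err addrA subrK.
rewrite rscaleDl !mulmxDr !mulmxN !opprB opprD.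
move: quad; set a := C *m Z; set b := C *m (B^T *m a).
set d := B *m rscale (_ - _) Z; set f := S *m _; set h := B *m rscale (err Z) Z.
set k := C *m (B^T *m V) => /eqP.
rewrite addr_eq0 => /eqP fE; have -> : - f = a + b + d by rewrite fE.
by rewrite !addrA [LHS](ACl (4 * 1 * 2 * 5 * 7 * (6 * 3)))/= subrr addr0.
Qed.

Lemma err_derive (Z : R -> 'M[R]_(q, m)) (t : R) Z' : is_derive t 1 Z Z' ->
  is_derive t 1 (fun s => err (Z s)) (rdot Z' (Z t) + rdot (Z t) Z').
Proof.
move=> dZ; apply: (is_derive_eq (is_deriveB (is_derive_rdot dZ dZ)
  (is_derive_cst (rdot Zs Zs) t 1))).
by rewrite subr0.
Qed.

Definition lyapunov (b : R) (Z : 'M[R]_(q, m)) (Y : 'M[R]_(n, m)) : R :=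
  2^-1 * fdot (err Z) (err Z) + fdot Y Y + b * fdot (B *m rscale (err Z) Z) Y.

Lemma lyapunov_bounds (b M : R) Z Y : 0 <= b -> b * M ^+ 2 <= 2^-1 ->
  fnorm B <= M -> fnorm Z <= M ->
  4^-1 * (fnorm (err Z) ^+ 2 + fnorm Y ^+ 2) <= lyapunov b Z Y
    <= fnorm (err Z) ^+ 2 + 2 * fnorm Y ^+ 2.
Proof.
move=> b0 bM BM ZM; rewrite /lyapunov -!fnormsq.
set a := fnorm (err Z); set y := fnorm Y.
have a0 : 0 <= a := fnorm_ge0 _; have y0 : 0 <= y := fnorm_ge0 _.
have M0 : 0 <= M := le_trans (fnorm_ge0 _) BM.
have NY : `|fdot (B *m rscale (err Z) Z) Y| <= M ^+ 2 * (a * y).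
  rewrite (le_trans (fdot_CS _ _))// mulrA ler_wpM2r ?fnorm_ge0//.
  rewrite (le_trans (fnorm_mul _ _))// expr2 -mulrA ler_pM ?fnorm_ge0//.
  by rewrite (le_trans (fnorm_rscale _ _))// mulrC ler_wpM2r ?fnorm_ge0.
have : `|b * fdot (B *m rscale (err Z) Z) Y| <= 2^-1 * (a * y).
  rewrite normrM (ger0_norm b0) (le_trans (ler_wpM2l b0 NY))// (mulrA b).
  by rewrite ler_wpM2r// mulr_ge0.
have := sqr_ge0 (a - y); have := sqr_ge0 (a + y).
have := sqr_ge0 a; have := sqr_ge0 y.
by rewrite ler_norml => ? ? ? ? /andP[? ?]; apply/andP; split; lra.
Qed.

(** In the derivative of the energy the coupling of the error with the velocity
    deviation cancels, the force B diag(E) Z being the gradient of the potential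
    energy; the scalar inequality is then fed with norm estimates. *)
Lemma lyapunov_decrease (M c b k g : R) :
  (forall kap a y nn EG YCY NY N'Y NCY : R, 0 <= kap <= k -> 0 <= a -> 0 <= y ->
    EG <= kap * M * a ^+ 2 -> - YCY <= kap * M * y ^+ 2 ->
    `|NY| <= M ^+ 2 * (a * y) -> N'Y <= 3 * M ^+ 4 * (y + a) * y ->
    - NCY <= M ^+ 3 * (a * y) -> c * a <= nn ->
    2 * (NY + EG) + 2 * (- y ^+ 2 - NY - YCY)
      + b * (N'Y + (- NY - nn ^+ 2 - NCY))
    <= - g * (2^-1 * a ^+ 2 + y ^+ 2 + b * NY)) ->
  1 <= M -> k <= 1 -> fnorm B <= M -> fnorm C <= k ->
  forall (P V : R -> 'M[R]_(n, m)) (t : R),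
  let Z s := B^T *m P s in let Y s := V s - C *m Z s in
  stationary ->
  is_derive t 1 P (V t) -> is_derive t 1 V (acceleration (Z t) (V t)) ->
  fnorm (Z t) <= M -> fnorm (err (Z t)) <= M ->
  fnorm (rdot (Z t) (B^T *m (C *m Z t))) <= fnorm C * M * fnorm (err (Z t)) ->
  c * fnorm (err (Z t)) <= fnorm (B *m rscale (err (Z t)) (Z t)) ->
  exists2 W', is_derive t 1 (fun s => lyapunov b (Z s) (Y s)) W' &
              W' <= - g * lyapunov b (Z t) (Y t).
Proof.
move=> scal M1 k1 BM Ck P V t Z Y st dP dV ZM EM GM cN.
have dZ : is_derive t 1 Z (B^T *m V t) by exact: is_derive_mull.
have dY : is_derive t 1 Y (- Y t - B *m rscale (err (Z t)) (Z t) - C *m (B^T *m Y t)).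
  rewrite -acceleration_shift//; apply: is_deriveB => //.
  exact: is_derive_mull.
have dE := err_derive dZ.
have dN := is_derive_mull B (is_derive_rscale dE dZ).
have dEE := is_derive_fdot dE dE; have dYY := is_derive_fdot dY dY.
have dNY := is_derive_fdot dN dY.
pose N' := B *m (rscale (rdot (B^T *m V t) (Z t) + rdot (Z t) (B^T *m V t)) (Z t)
                 + rscale (err (Z t)) (B^T *m V t)).
exists (2 * (fdot (B *m rscale (err (Z t)) (Z t)) (Y t)
             + fdot (err (Z t)) (rdot (Z t) (B^T *m (C *m Z t))))
  + 2 * (- fnorm (Y t) ^+ 2 - fdot (B *m rscale (err (Z t)) (Z t)) (Y t)
         - fdot (Y t) (C *m (B^T *m Y t)))
  + b * (fdot N' (Y t) + (- fdot (B *m rscale (err (Z t)) (Z t)) (Y t)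
     - fnorm (B *m rscale (err (Z t)) (Z t)) ^+ 2
     - fdot (B *m rscale (err (Z t)) (Z t)) (C *m (B^T *m Y t))))).
  have d1 := is_derive_mulE (is_derive_cst (2^-1 : R) t 1) dEE.
  have d3 := is_derive_mulE (is_derive_cst b t 1) dNY.
  apply: (is_derive_eq (is_deriveD (is_deriveD d1 dYY) d3)).
  rewrite -/N' !mul0r !add0r !fnormsq /cst.
  have VE : V t = C *m Z t + Y t by rewrite /Y addrC subrK.
  have NYE : fdot (err (Z t)) (rdot (Z t) (B^T *m Y t)) =
      fdot (B *m rscale (err (Z t)) (Z t)) (Y t).
    by rewrite fdot_mull -fdot_rdot.
  have EE : fdot (err (Z t)) (rdot (B^T *m V t) (Z t) + rdot (Z t) (B^T *m V t)) =
     2 * (fdot (B *m rscale (err (Z t)) (Z t)) (Y t)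
          + fdot (err (Z t)) (rdot (Z t) (B^T *m (C *m Z t)))).
    rewrite (rdotC _ (Z t)) fdotDr VE mulmxDr rdotDr fdotDr NYE; ring.
  rewrite (fdotC _ (err (Z t))) EE; move: (Y t) => y.
  rewrite (fdotC (- y - _ - _) y) !fdotBr !fdotNr (fdotC y (B *m _)).
  by field.
have kap0 := fnorm_ge0 C; have a0 := fnorm_ge0 (err (Z t)).
have y0 := fnorm_ge0 (Y t); have M0 : 0 <= M by lra.
have C1 : fnorm C <= 1 := le_trans Ck k1.
have BY : fnorm (B^T *m Y t) <= M * fnorm (Y t).
  by rewrite (le_trans (fnorm_mul _ _))// fnorm_tr ler_wpM2r.
have CBY : fnorm (C *m (B^T *m Y t)) <= fnorm C * (M * fnorm (Y t)).
  by rewrite (le_trans (fnorm_mul _ _))// ler_wpM2l.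
have CBY1 : fnorm (C *m (B^T *m Y t)) <= M * fnorm (Y t).
  by rewrite (le_trans CBY)// -[leRHS]mul1r ler_wpM2r// mulr_ge0.
have NM : fnorm (B *m rscale (err (Z t)) (Z t)) <= M ^+ 2 * fnorm (err (Z t)).
  rewrite (le_trans (fnorm_mul _ _))// expr2 -mulrA ler_pM ?fnorm_ge0//.
  by rewrite (le_trans (fnorm_rscale _ _))// mulrC ler_wpM2r.
rewrite /lyapunov -!fnormsq; apply: (scal (fnorm C)) => //.
- by rewrite kap0.
- rewrite (le_trans (fdot_le _ _))// (le_trans (ler_wpM2l a0 GM))//.
  by rewrite le_eqVlt; apply/orP; left; apply/eqP; ring.
- rewrite -fdotNr (le_trans (fdot_le _ _))// fnormN (le_trans (ler_wpM2l y0 CBY))//.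
  by rewrite le_eqVlt; apply/orP; left; apply/eqP; ring.
- by rewrite (le_trans (fdot_CS _ _))// mulrA ler_wpM2r.
- have VM : fnorm (B^T *m V t) <= M * (M + fnorm (Y t)).
    rewrite (le_trans (fnorm_mul _ _))// fnorm_tr ler_pM ?fnorm_ge0//.
    have -> : V t = C *m Z t + Y t by rewrite /Y addrC subrK.
    rewrite (le_trans (fnormD _ _))// lerD2r (le_trans (fnorm_mul _ _))//.
    by rewrite -[leRHS]mul1r ler_pM ?fnorm_ge0.
  have EM' : fnorm (rdot (B^T *m V t) (Z t) + rdot (Z t) (B^T *m V t)) <=
      2 * (M ^+ 2 * fnorm (Y t) + M * fnorm (err (Z t))).
    rewrite (rdotC _ (Z t)).
    suff rM : fnorm (rdot (Z t) (B^T *m V t)) <=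
        M ^+ 2 * fnorm (Y t) + M * fnorm (err (Z t)).
      by have := fnormD (rdot (Z t) (B^T *m V t)) (rdot (Z t) (B^T *m V t)); lra.
    have -> : B^T *m V t = B^T *m Y t + B^T *m (C *m Z t).
      by rewrite -mulmxDr /Y subrK.
    rewrite rdotDr (le_trans (fnormD _ _))// lerD//.
      by rewrite (le_trans (fnorm_rdot _ _))// expr2 -mulrA ler_pM ?fnorm_ge0.
    by rewrite (le_trans GM)// ler_wpM2r// -[leRHS]mul1r ler_wpM2r.
  have NM' : fnorm N' <= 3 * M ^+ 4 * (fnorm (Y t) + fnorm (err (Z t))).
    have : fnorm N' <= M * (2 * (M ^+ 2 * fnorm (Y t) + M * fnorm (err (Z t))) * M
        + fnorm (err (Z t)) * (M * (M + fnorm (Y t)))).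
      rewrite (le_trans (fnorm_mul _ _))// ler_pM ?fnorm_ge0//.
      rewrite (le_trans (fnormD _ _))// lerD// (le_trans (fnorm_rscale _ _))//.
        by rewrite ler_pM ?fnorm_ge0.
      by rewrite ler_wpM2l.
    move=> /le_trans; apply.
    have M34 : M ^+ 3 <= M ^+ 4 by rewrite ler_weXn2l.
    have M24 : M ^+ 2 <= M ^+ 3 by rewrite ler_weXn2l.
    have H1 := ler_wpM2r a0 M34; have H2 := ler_wpM2r y0 M34.
    have H3 : M ^+ 2 * (fnorm (err (Z t)) * fnorm (Y t)) <= M ^+ 3 * fnorm (Y t).
      by rewrite (exprSr M 2) -mulrA ler_wpM2l ?exprn_ge0// ler_wpM2r.
    by lra.
  by rewrite (le_trans (fdot_le _ _))// ler_wpM2r.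
- rewrite -fdotNr (le_trans (fdot_le _ _))// fnormN.
  rewrite (_ : M ^+ 3 * _ = M ^+ 2 * fnorm (err (Z t)) * (M * fnorm (Y t))); last by ring.
  by rewrite ler_pM ?fnorm_ge0.
Qed.

End ErrorDynamics.

(** The difference of the squared lengths is a sum of inner products with the
    difference of Z and the rotated copy of Zs. *)
Lemma err_near (R : realType) (q m : nat) (Z Zs : 'M[R]_(q, m)) (Q : 'M[R]_m) (M : R) :
  rotation Q -> fnorm Z <= M -> fnorm Zs <= M ->
  fnorm (err Zs Z) <= 2 * M * fnorm (Z - Zs *m Q^T).
Proof.
move=> rQ ZM ZsM; have M0 : 0 <= M := le_trans (fnorm_ge0 _) ZM.
have QQ : Q^T *m Q^T^T = 1%:M by rewrite trmxK; case: rQ.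
rewrite /err -(rdot_orth Zs Zs QQ); set U := Zs *m Q^T.
have UM : fnorm U <= M by rewrite fnorm_orth.
have -> : rdot Z Z - rdot U U = rdot (Z - U) Z + rdot U (Z - U).
  by rewrite rdotBl rdotBr (rdotC U Z) addrA subrK.
have := fnormD (rdot (Z - U) Z) (rdot U (Z - U)).
have := fnorm_rdot (Z - U) Z; have := fnorm_rdot U (Z - U).
have := ler_wpM2r (fnorm_ge0 (Z - U)) ZM.
have := ler_wpM2r (fnorm_ge0 (Z - U)) UM.
by lra.
Qed.

(** Near the desired shape, up to a rotation, everything that the decrease of
    the Lyapunov function needs holds with uniform constants.  The flow term
    vanishes on the orbit of the limit shape, so by local rigidity it is bounded
    by the error. *)
Lemma near_estimates (R : realType) (n m q : nat) (G : sensing_graph n q)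
    (pd : 'cV[R]_(n * m)) :
  (2 <= n)%N -> m = 2%N \/ m = 3%N -> inf_min_rigid G pd ->
  let B := incidence R G in let Zd := B^T *m unstack pd in
  exists rho d M c Ka : R,
  [/\ 0 < rho, 0 < d, 1 <= M /\ fnorm B <= M, 0 < c /\ 0 <= Ka &
  forall (C : 'M[R]_(n, q)) (P Ps : 'M[R]_(n, m)) (Q : 'M[R]_m),
  let Z := B^T *m P in let Zs := B^T *m Ps in
  fnorm (Zs - Zd) <= rho -> rdot Zs (B^T *m (C *m Zs)) = 0 ->
  rotation Q -> fnorm (Z - Zs *m Q^T) <= d ->
  [/\ fnorm Z <= M /\ fnorm Zs <= M, fnorm (err Zs Z) <= M,
      fnorm (rdot Z (B^T *m (C *m Z))) <= fnorm C * M * fnorm (err Zs Z),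
      c * fnorm (err Zs Z) <= fnorm (B *m rscale (err Zs Z) Z) &
      exists2 Q', rotation Q' & fnorm (Z - Zs *m Q'^T) <= Ka * fnorm (err Zs Z)]].
Proof.
move=> n2 m23 rigid B Zd.
have [rho_a [delta_a [Ka [rho_a0 delta_a0 Ka0 align]]]] := alignment n2 m23 rigid.
have [c [rho_c [c0 rho_c0 coer]]] := stress_coercive rigid.
have b0 := fnorm_ge0 B.
pose M0 := fnorm Zd + 2.
have M00 : 0 <= M0 by rewrite addr_ge0 ?fnorm_ge0.
pose M := 1 + fnorm B + M0 + 2 * M0 ^+ 2 + 2 * (Ka * M0 * fnorm B).
have KMB : 0 <= Ka * M0 * fnorm B by rewrite !mulr_ge0.
have M02 : 0 <= M0 ^+ 2 by rewrite sqr_ge0.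
have [M1 BM M0M M2M KM] : [/\ 1 <= M, fnorm B <= M, M0 <= M, 2 * M0 ^+ 2 <= M &
    2 * (Ka * M0 * fnorm B) <= M].
  by move: b0 M00 KMB M02; rewrite /M; clear; split; lra.
exists (Num.min 1 (Num.min rho_a (rho_c / 2))).
exists (Num.min 1 (Num.min delta_a (rho_c / 2))), M, c, Ka.
split; rewrite ?lt_min ?ltr01 ?rho_a0 ?delta_a0 ?divr_gt0//.
move=> C P Ps Q Z Zs; rewrite !le_min => /and3P[rho1 rhoa rhoc] flow rQ.
move=> /and3P[d1 da dc].
have QQ (U : 'M[R]_m) : rotation U -> U^T *m U^T^T = 1%:M by rewrite trmxK; case.
have ZsM0 : fnorm Zs <= M0 - 1.
  have := fnormD (Zs - Zd) Zd; rewrite subrK /M0 => /le_trans; apply.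
  by rewrite addrC -addrA lerD2l; apply: le_trans rho1 _; clear; lra.
have ZsM : fnorm Zs <= M0 by move: ZsM0; clear; lra.
have ZM : fnorm Z <= M0.
  have := fnormD (Z - Zs *m Q^T) (Zs *m Q^T); rewrite subrK fnorm_orth ?QQ//.
  move=> /le_trans; apply; rewrite (le_trans (lerD d1 ZsM0))// addrC subrK.
  exact: lexx.
have a0 := fnorm_ge0 (err Zs Z).
have [Q' rQ' ZQ'] := align P Ps Q rhoa rQ da.
split; last by exists Q'.
- by split; exact: le_trans M0M.
- rewrite /err (le_trans (fnormB _ _))// (le_trans _ M2M)//.
  rewrite (_ : 2 * M0 ^+ 2 = M0 * M0 + M0 * M0); last by ring.
  by rewrite lerD// (le_trans (fnorm_rdot _ _))// ler_pM ?fnorm_ge0.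
- set U := Zs *m Q'^T in ZQ'.
  have UG : rdot U (B^T *m (C *m U)) = 0.
    by rewrite /U (mulmxA C) (mulmxA B^T) rdot_orth ?QQ.
  have -> : rdot Z (B^T *m (C *m Z)) =
      rdot (Z - U) (B^T *m (C *m Z)) + rdot U (B^T *m (C *m (Z - U))).
    by rewrite rdotBl !mulmxBr rdotBr UG subr0 subrK.
  have UM : fnorm U <= M0 by rewrite fnorm_orth ?QQ.
  have BC (X : 'M[R]_(q, m)) : fnorm (B^T *m (C *m X)) <= fnorm B * (fnorm C * fnorm X).
    by rewrite (le_trans (fnorm_mul _ _))// fnorm_tr ler_wpM2l// fnorm_mul.
  have C0 := fnorm_ge0 C; have D0 := fnorm_ge0 (Z - U).
  rewrite (le_trans (fnormD _ _))//.
  have H1 : fnorm (rdot (Z - U) (B^T *m (C *m Z))) <=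
      M0 * (fnorm B * (fnorm C * fnorm (Z - U))).
    rewrite (_ : M0 * _ = fnorm (Z - U) * (fnorm B * (fnorm C * M0))); last by ring.
    rewrite (le_trans (fnorm_rdot _ _))// ler_wpM2l// (le_trans (BC Z))//.
    by rewrite ler_wpM2l// ler_wpM2l.
  have H2 : fnorm (rdot U (B^T *m (C *m (Z - U)))) <=
      M0 * (fnorm B * (fnorm C * fnorm (Z - U))).
    by rewrite (le_trans (fnorm_rdot _ _))// ler_pM ?fnorm_ge0.
  rewrite (le_trans (lerD H1 H2))//.
  have H3 : M0 * (fnorm B * (fnorm C * fnorm (Z - U))) <=
      M0 * (fnorm B * (fnorm C * (Ka * fnorm (err Zs Z)))).
    by rewrite ler_wpM2l// ler_wpM2l// ler_wpM2l.
  rewrite (le_trans (lerD H3 H3))//.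
  rewrite (_ : _ + _ = 2 * (Ka * M0 * fnorm B) * (fnorm C * fnorm (err Zs Z))); last by ring.
  rewrite (_ : fnorm C * M * _ = M * (fnorm C * fnorm (err Zs Z))); last by ring.
  by rewrite ler_wpM2r// mulr_ge0.
- have <- : fnorm (B *m rscale (err Zs Z) (Z *m Q)) = fnorm (B *m rscale (err Zs Z) Z).
    by rewrite /rscale !mulmxA fnorm_orth//; exact: rotation_mulT.
  apply: coer; rewrite -/B -/Zd.
  have -> : Z *m Q - Zd = (Z - Zs *m Q^T) *m Q + (Zs - Zd).
    rewrite mulmxBl -(mulmxA Zs); case: (rQ) => -> _.
    by rewrite mulmx1 addrA subrK.
  rewrite (le_trans (fnormD _ _))// fnorm_orth ?rotation_mulT//.
  by rewrite [leRHS](splitr rho_c) lerD.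
Qed.

(** While the shape stays near the orbit of Zs the Lyapunov function decays, and
    its smallness implies, by local rigidity, that the shape is twice as near as
    required; hence it stays near forever.  The constants do not depend on the
    mismatches.  The rotation in the conclusion is chosen separately at each
    time. *)
Lemma error_decay (R : realType) (n m q : nat) (G : sensing_graph n q)
    (pd : 'cV[R]_(n * m)) (S : 'M[R]_(n, q)) :
  (2 <= n)%N -> m = 2%N \/ m = 3%N -> inf_min_rigid G pd ->
  let B := incidence R G in let Zd := B^T *m unstack pd in
  exists rho k delta g K : R,
  [/\ 0 < rho, 0 < k, 0 < delta, 0 < g & forall (C : 'M[R]_(n, q)) mu Ps,
   let Zs := B^T *m Ps in
   fnorm (Zs - Zd) <= rho -> fnorm C <= k -> stationary B S C mu Zs Zd ->
   forall (P V : R -> 'M[R]_(n, m)) (t0 : R),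
   let Z t := B^T *m P t in
   (forall t, t0 <= t -> is_derive t 1 P (V t)) ->
   (forall t, t0 <= t -> is_derive t 1 V (acceleration B S mu Zd (Z t) (V t))) ->
   (exists2 Q, rotation Q & fnorm (Z t0 - Zd *m Q^T) <= delta) ->
   fnorm (V t0) <= delta ->
   forall t, t0 <= t ->
     let bound := K * expR (- g * (t - t0)) in
     [/\ fnorm (err Zs (Z t)) <= bound, fnorm (V t - C *m Z t) <= bound &
         exists2 Q, rotation Q & fnorm (Z t - Zs *m Q^T) <= bound]].
Proof.
move=> n2 m23 rigid B Zd.
have [rho [d [M [c [Ka [rho0 d0 [M1 BM] [c0 Ka0] est]]]]]] :=
  near_estimates n2 m23 rigid.
have [b [k [g [bpos /andP[k0 k1] g0 bM scal]]]] := lyapunov_scalars M1 c0.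
have M0 : 0 <= M by exact: le_trans ler01 M1.
(* initial values of size sig make the error at most 2 s, which local rigidity
   turns into a distance at most d / 2 to the orbit *)
have [s s0 sd] : exists2 s : R, 0 < s & s * (4 * (Ka + 1)) <= d.
  have Ka4 : 0 < 4 * (Ka + 1) by rewrite mulr_gt0// ltr_wpDl.
  by exists (d / (4 * (Ka + 1))); rewrite ?divr_gt0// divfK// gt_eqF.
have [sig [sig0 sigd sigs]] : exists sig : R,
    [/\ 0 < sig, sig <= d / 4 & sig * (6 * M + 2) <= s].
  have M62 : 0 < 6 * M + 2 by rewrite ltr_wpDl// mulr_ge0.
  exists (Num.min (d / 4) (s / (6 * M + 2))).
  by rewrite lt_min !divr_gt0// -ler_pdivlMr// !ge_min !lexx orbT.
have s_ge0 := ltW s0.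
have initial (x y : R) : 0 <= x -> 0 <= y -> x <= 4 * M * sig -> y <= (1 + M) * sig ->
    x ^+ 2 + 2 * y ^+ 2 <= s ^+ 2.
  move=> x0 y0 xs ys.
  have sum : x + 2 * y <= s by move: xs ys sigs; clear; lra.
  have sum0 : 0 <= x + 2 * y by rewrite addr_ge0// mulr_ge0.
  have : (x + 2 * y) ^+ 2 <= s ^+ 2 by rewrite lerXn2r ?nnegrE.
  move=> /(le_trans _); apply; have := mulr_ge0 x0 y0; have := sqr_ge0 y.
  by clear; lra.
exists (Num.min rho sig), (Num.min k sig), sig, (g / 2), (2 * s * (Ka + 1)).
split=> //; rewrite ?lt_min ?rho0 ?sig0 ?k0 ?divr_gt0//.
move=> C mu Ps Zs; rewrite !le_min => /andP[rhor rhos] /andP[Ck Csig] st.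
move=> P V t0 Z dP dV [Q0 rQ0 Z0] V0.
pose O := [set U | exists2 Q : 'M[R]_m, rotation Q & U = Zs *m Q^T].
pose near e t := exists2 U, O U & fnorm (Z t - U) <= e.
have near_est t : near d t ->
  [/\ fnorm (Z t) <= M /\ fnorm Zs <= M, fnorm (err Zs (Z t)) <= M,
      fnorm (rdot (Z t) (B^T *m (C *m Z t))) <= fnorm C * M * fnorm (err Zs (Z t)),
      c * fnorm (err Zs (Z t)) <= fnorm (B *m rscale (err Zs (Z t)) (Z t)) &
      exists2 Q', rotation Q' &
        fnorm (Z t - Zs *m Q'^T) <= Ka * fnorm (err Zs (Z t))].
  by move=> [_ [Q rQ ->] ZU]; exact: (est C (P t) Ps Q rhor st.2 rQ ZU).
pose W t := lyapunov B Zs b (Z t) (V t - C *m Z t).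
have decrease t : t0 <= t -> near d t ->
    exists2 W', is_derive t 1 W W' & W' <= - g * W t.
  move=> tt0 /near_est[[ZM _] EM GM cN _].
  exact: (lyapunov_decrease scal M1 k1 BM Ck st (dP t tt0) (dV t tt0)).
have nearQ0 : fnorm (Z t0 - Zs *m Q0^T) <= 2 * sig.
  have -> : Z t0 - Zs *m Q0^T = (Z t0 - Zd *m Q0^T) - (Zs - Zd) *m Q0^T.
    by rewrite mulmxBl opprB addrA subrK.
  rewrite (le_trans (fnormB _ _))// fnorm_orth; last by rewrite trmxK; case: rQ0.
  by rewrite (le_trans (lerD Z0 rhos))// mulrDl mul1r.
have near0 : near (d / 2) t0.
  exists (Zs *m Q0^T); first by exists Q0.
  by apply: (le_trans nearQ0); move: sigd; clear; lra.
have near0d : near d t0.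
  case: near0 => U OU ZU; exists U => //; apply: (le_trans ZU).
  by move: d0; clear; lra.
have W0 : W t0 <= s ^+ 2.
  have [[ZM ZsM] _ _ _ _] := near_est t0 near0d.
  have /andP[_ /le_trans] := lyapunov_bounds Zs (V t0 - C *m Z t0) (ltW bpos) bM BM ZM.
  apply.
  have E0 : fnorm (err Zs (Z t0)) <= 4 * M * sig.
    rewrite (le_trans (err_near rQ0 ZM ZsM))//.
    rewrite (_ : 4 * M * sig = 2 * M * (2 * sig)); last by ring.
    by rewrite ler_wpM2l ?mulr_ge0.
  have Y0 : fnorm (V t0 - C *m Z t0) <= (1 + M) * sig.
    rewrite (le_trans (fnormB _ _))// mulrDl mul1r lerD//.
    by rewrite (le_trans (fnorm_mul _ _))// mulrC ler_pM ?fnorm_ge0.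
  exact: initial (fnorm_ge0 _) (fnorm_ge0 _) E0 Y0.
have decay t : t0 <= t -> (forall u, t0 <= u <= t -> near d u) ->
    fnorm (err Zs (Z t)) <= 2 * s * expR (- (g / 2) * (t - t0)) /\
    fnorm (V t - C *m Z t) <= 2 * s * expR (- (g / 2) * (t - t0)).
  move=> tt0 nt.
  have /choice[W' dW] u : exists w : R, t0 <= u <= t ->
      is_derive u 1 W w /\ w <= - g * W u.
    have [tu|_] := boolP (t0 <= u <= t); last by exists 0.
    have /andP[tu1 _] := tu.
    by have [w ? ?] := decrease u tu1 (nt u tu); exists w.
  have Wt := exp_decay tt0 (fun u h => (dW u h).1) (fun u h => (dW u h).2).
  have ntt : near d t by apply: nt; rewrite tt0 lexx.
  have [[ZM _] _ _ _ _] := near_est t ntt.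
  have /andP[lowW _] := lyapunov_bounds Zs (V t - C *m Z t) (ltW bpos) bM BM ZM.
  set ex := expR (- (g / 2) * (t - t0)).
  have ex0 : 0 <= ex := expR_ge0 _.
  have exE : expR (- g * (t - t0)) = ex ^+ 2.
    by rewrite -expRM_natl; congr expR; field.
  have Wb : W t <= s ^+ 2 * ex ^+ 2.
    by rewrite -exE (le_trans Wt)// ler_wpM2r// expR_ge0.
  have sq (x y : R) : 4^-1 * (x ^+ 2 + y ^+ 2) <= s ^+ 2 * ex ^+ 2 ->
     0 <= x -> x <= 2 * s * ex.
    move=> H x0; rewrite -(@ler_pXn2r _ 2) ?nnegrE ?mulr_ge0//.
    by rewrite !exprMn; have := sqr_ge0 y; move: H; clear; lra.
  have := le_trans lowW Wb => H; split; first exact: sq H (fnorm_ge0 _).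
  by rewrite addrC in H; exact: sq H (fnorm_ge0 _).
have sKa : Ka * (2 * s) <= d / 2 by move: s_ge0 sd; clear; lra.
have exle1 t : t0 <= t -> expR (- (g / 2) * (t - t0)) <= 1.
  move=> tt0; rewrite -expR0 ler_expR mulNr oppr_le0 mulr_ge0 ?subr_ge0//.
  by rewrite ltW// divr_gt0.
have Zc u : t0 <= u -> {for u, continuous Z}.
  move=> tu; have dZ : is_derive u 1 Z (B^T *m V u) := is_derive_mull B^T (dP u tu).
  apply: differentiable_continuous; apply/derivable1_diffP.
  exact: (@ex_derive _ _ _ _ _ _ _ dZ).
have improve u : t0 <= u -> (forall v, t0 <= v <= u -> near d v) -> near (d / 2) u.
  move=> tu nu; have [Eu _] := decay u tu nu.
  have nuu : near d u by apply: nu; rewrite tu lexx.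
  have [_ _ _ _ [Q rQ ZQ]] := near_est u nuu.
  exists (Zs *m Q^T); first by exists Q.
  apply: (le_trans ZQ); apply: (le_trans _ sKa); apply: ler_wpM2l => //.
  apply: (le_trans Eu); rewrite -[leRHS]mulr1; apply: ler_wpM2l; last exact: exle1.
  by rewrite mulr_ge0.
have all_near : forall t, t0 <= t -> near d t := trapped d0 Zc near0 improve.
move=> t tt0 bound.
have [Et Yt] := decay t tt0 (fun u h => all_near u (andP h).1).
have s2 : 0 <= 2 * s by rewrite mulr_ge0.
have sb : 2 * s * expR (- (g / 2) * (t - t0)) <= bound.
  by rewrite ler_wpM2r ?expR_ge0// ler_peMr// lerDr.
split; [exact: le_trans sb|exact: le_trans sb|].
have [_ _ _ _ [Q rQ ZQ]] := near_est t (all_near t tt0); exists Q => //.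
apply: (le_trans ZQ); apply: (le_trans (ler_wpM2l Ka0 Et)).
rewrite mulrA ler_wpM2r ?expR_ge0// mulrC ler_wpM2l// lerDl.
exact: ler01.
Qed.

(** * Asymptotic phase *)

Section Phase.
Variables (R : realType) (q m : nat) (F : 'M[R]_q) (g K T0 : R).
Hypotheses (g0 : 0 < g) (K0 : 0 <= K) (Fg : fnorm F <= g / 8).

(** D is the difference of a solution of Z' = F Z + eta and a solution of the
    homogeneous equation; eta decays faster than D can grow backwards in time, so
    the bound at the late time T is only weakened by a factor in the rate. *)
Lemma backward_gronwall (D eta : R -> 'M[R]_(q, m)) (T t : R) :
  T0 <= t <= T ->
  (forall s, T0 <= s -> is_derive s 1 D (F *m D s + eta s)) ->
  (forall s, T0 <= s -> fnorm (eta s) <= K * expR (- g * (s - T0))) ->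
  fnorm (D T) <= K * expR (- g * (T - T0)) ->
  fdot (D t) (D t) <= (K ^+ 2 + 8 * K ^+ 2 / g ^+ 2) * expR (- (g / 2) * (t - T0)).
Proof.
move=> /andP[T0t tT] dD etaK DT.
have gN0 : g != 0 by rewrite gt_eqF.
(* f is nonincreasing because phi' >= - (g / 2) phi - (4 / g) |eta|^2 for
   phi = |D|^2 *)
pose f s := (8 * K ^+ 2 / g ^+ 2) * (expR (- (3 * g / 2) * s) * expR (2 * g * T0)) -
            fdot (D s) (D s) * expR (g / 2 * s).
pose f' s := (8 * K ^+ 2 / g ^+ 2) * (- (3 * g / 2) * expR (- (3 * g / 2) * s) * expR (2 * g * T0)) -
   ((fdot (F *m D s + eta s) (D s) + fdot (D s) (F *m D s + eta s)) * expR (g / 2 * s)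
    + fdot (D s) (D s) * (g / 2 * expR (g / 2 * s))).
have df s : T0 <= s -> is_derive s 1 f (f' s).
  move=> T0s.
  have d1 := is_derive_mulE (is_derive_cst (8 * K ^+ 2 / g ^+ 2) s 1)
    (is_derive_mulE (is_derive_expR_lin (- (3 * g / 2)) s)
       (is_derive_cst (expR (2 * g * T0)) s 1)).
  have d2 := is_derive_mulE (is_derive_fdot (dD s T0s) (dD s T0s))
    (is_derive_expR_lin (g / 2) s).
  apply: (is_derive_eq (is_deriveB d1 d2)).
  by rewrite /f' mul0r add0r mulr0 addr0.
have f'0 s : T0 <= s -> f' s <= 0.
  move=> T0s; rewrite /f' (fdotC (_ + _)) fdotDr.
  have e0 := expR_gt0 (g / 2 * s).
  have H1 : - fdot (D s) (F *m D s) <= g / 8 * fdot (D s) (D s).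
    rewrite -fdotNr (le_trans (fdot_le _ _))// fnormN -fnormsq.
    rewrite (le_trans (ler_wpM2l (fnorm_ge0 _) (fnorm_mul _ _)))// mulrCA -expr2.
    by rewrite ler_wpM2r ?sqr_ge0.
  have H2 : - fdot (D s) (eta s) <= g / 8 * fdot (D s) (D s) + 2 / g * fnorm (eta s) ^+ 2.
    rewrite -fdotNr (le_trans (fdot_le _ _))// fnormN -fnormsq.
    have : 0 <= g / 8 * (fnorm (D s) - 4 / g * fnorm (eta s)) ^+ 2.
      by rewrite mulr_ge0 ?sqr_ge0// divr_ge0// ltW.
    have -> : g / 8 * (fnorm (D s) - 4 / g * fnorm (eta s)) ^+ 2 =
      g / 8 * fnorm (D s) ^+ 2 + 2 / g * fnorm (eta s) ^+ 2 - fnorm (D s) * fnorm (eta s).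
      by field.
    by rewrite subr_ge0.
  have H3 : fnorm (eta s) ^+ 2 <= K ^+ 2 * expR (- (2 * g) * (s - T0)).
    have -> : expR (- (2 * g) * (s - T0)) = expR (- g * (s - T0)) ^+ 2.
      by rewrite -expRM_natl; congr expR; ring.
    by rewrite -exprMn lerXn2r ?nnegrE ?fnorm_ge0 ?mulr_ge0 ?expR_ge0 ?etaK.
  have eE : expR (- (3 * g / 2) * s) * expR (2 * g * T0) =
      expR (- (2 * g) * (s - T0)) * expR (g / 2 * s).
    by rewrite -!expRD; congr expR; field.
  have -> : 8 * K ^+ 2 / g ^+ 2 * (- (3 * g / 2) * expR (- (3 * g / 2) * s) * expR (2 * g * T0))
    = - (12 / g * (K ^+ 2 * expR (- (2 * g) * (s - T0)))) * expR (g / 2 * s).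
    rewrite [LHS](_ : _ = 8 * K ^+ 2 / g ^+ 2 * (- (3 * g / 2)) *
      (expR (- (3 * g / 2) * s) * expR (2 * g * T0))); last by ring.
    by rewrite eE; field.
  set p := fdot (D s) (D s) in H1 H2 *; set a := fdot (D s) (F *m D s) in H1 *.
  set b := fdot (D s) (eta s) in H2 *; set e := expR (g / 2 * s) in e0 *.
  set h := K ^+ 2 * _ in H3 *.
  have h0 : 0 <= h by rewrite mulr_ge0 ?sqr_ge0 ?expR_ge0.
  have H4 : 2 / g * fnorm (eta s) ^+ 2 <= 2 / g * h by rewrite ler_wpM2l// divr_ge0// ltW.
  have -> : - (12 / g * h) * e - ((a + b + (a + b)) * e + p * (g / 2 * e)) =
     - (e * (12 / g * h + 2 * (a + b) + g / 2 * p)) by ring.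
  rewrite oppr_le0 mulr_ge0//; first exact: ltW.
  have : 0 <= 2 / g * h by rewrite mulr_ge0// divr_ge0// ltW.
  by rewrite (_ : 12 / g * h = 6 * (2 / g * h)); [lra|ring].
have T0u u : t <= u <= T -> T0 <= u by move=> /andP[tu _]; exact: le_trans tu.
have fT : f T <= f t := derive_le0_nincr tT (fun u h => df u (T0u u h))
  (fun u h => f'0 u (T0u u h)).
have DT2 : fdot (D T) (D T) <= K ^+ 2 * expR (- (2 * g) * (T - T0)).
  have -> : expR (- (2 * g) * (T - T0)) = expR (- g * (T - T0)) ^+ 2.
    by rewrite -expRM_natl; congr expR; ring.
  by rewrite -fnormsq -exprMn lerXn2r ?nnegrE ?fnorm_ge0 ?mulr_ge0 ?expR_ge0.
have c0 : 0 <= 8 * K ^+ 2 / g ^+ 2.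
  by rewrite divr_ge0 ?sqr_ge0// mulr_ge0// sqr_ge0.
rewrite -(@ler_pM2r _ (expR (g / 2 * t))) ?expR_gt0// -[leRHS]mulrA -expRD.
rewrite (_ : - (g / 2) * (t - T0) + g / 2 * t = g / 2 * T0); last by ring.
have : fdot (D t) (D t) * expR (g / 2 * t) <=
   fdot (D T) (D T) * expR (g / 2 * T) +
   8 * K ^+ 2 / g ^+ 2 * (expR (- (3 * g / 2) * t) * expR (2 * g * T0)).
  move: fT; rewrite /f.
  have : 0 <= 8 * K ^+ 2 / g ^+ 2 * (expR (- (3 * g / 2) * T) * expR (2 * g * T0)).
    by rewrite mulr_ge0// mulr_ge0// expR_ge0.
  by lra.
move=> /le_trans; apply; rewrite [leRHS]mulrDl lerD//.
  rewrite (le_trans (ler_wpM2r (expR_ge0 _) DT2))// -[leLHS]mulrA -expRD.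
  rewrite ler_wpM2l ?sqr_ge0// ler_expR.
  have : 0 <= g * (T - T0) by rewrite mulr_ge0 ?(ltW g0)// subr_ge0 (le_trans T0t).
  by lra.
rewrite ler_wpM2l// -[leLHS]expRD ler_expR.
have : 0 <= g * (t - T0) by rewrite mulr_ge0 ?(ltW g0)// subr_ge0.
by lra.
Qed.

(** The rotations that are nearly optimal at late times, transported backwards
    along the limiting motion, accumulate in the compact group of rotations; any
    accumulation point is an asymptotic phase. *)
Lemma asymptotic_phase (Z eta : R -> 'M[R]_(q, m)) (Zs : 'M[R]_(q, m)) (A : 'M[R]_m)
    (s : R) :
  A^T = - A -> A *m A *m A = - s ^+ 2 *: A -> (s = 0 -> A = 0) ->
  F *m Zs = Zs *m A^T ->
  (forall t, T0 <= t -> is_derive t 1 Z (F *m Z t + eta t)) ->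
  (forall t, T0 <= t -> fnorm (eta t) <= K * expR (- g * (t - T0))) ->
  (forall t, T0 <= t -> exists2 Q, rotation Q &
     fnorm (Z t - Zs *m Q^T) <= K * expR (- g * (t - T0))) ->
  exists2 U : 'M[R]_m, rotation U & forall t, T0 <= t ->
    fdot (Z t - Zs *m (U *m skew_exp A s t)^T) (Z t - Zs *m (U *m skew_exp A s t)^T)
    <= (K ^+ 2 + 8 * K ^+ 2 / g ^+ 2) * expR (- (g / 2) * (t - T0)).
Proof.
move=> A_skew A_cube A0 FZs dZ etaK nearZ.
pose X (U : 'M[R]_m) t := Zs *m (U *m skew_exp A s t)^T.
have dX (U : 'M[R]_m) (t : R) : is_derive t 1 (X U) (F *m X U t).
  apply: (is_derive_eq (is_derive_mull Zs (is_derive_trmx (is_derive_mull U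
     (is_derive_skew_exp A_cube A0 t))))).
  by rewrite /X !trmx_mul !mulmxA FZs.
have ex n : exists U, rotation U /\ fnorm (Z (T0 + n%:R) - X U (T0 + n%:R)) <=
    K * expR (- g * (T0 + n%:R - T0)).
  have [|Q rQ ZQ] := nearZ (T0 + n%:R); first by rewrite lerDl.
  exists (Q *m skew_exp A s (- (T0 + n%:R))); split.
    by apply: rotationM => //; exact: skew_exp_rotation.
  by rewrite /X -mulmxA -skew_expD// addNr skew_exp0 mulmx1.
have [U_ HU] := choice ex.
have [U [rU clU]] : (@rotation R m) `&` cluster (U_ @ \oo) !=set0.
  by apply: compact_rotation; exists 0%N => // n _; exact: (HU n).1.
exists U => // t T0t.
set bnd := _ * expR _.
have bnd0 : 0 <= bnd.
  rewrite mulr_ge0 ?expR_ge0// addr_ge0 ?sqr_ge0// divr_ge0 ?sqr_ge0//.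
  by rewrite mulr_ge0// sqr_ge0.
pose phi (V : 'M[R]_m) := fnorm (Z t - X V t).
have phi_bnd V : (fdot (Z t - X V t) (Z t - X V t) <= bnd) = (phi V <= Num.sqrt bnd).
  rewrite -fnormsq -{1}(sqr_sqrtr bnd0) ler_pXn2r ?nnegrE ?fnorm_ge0 ?sqrtr_ge0//.
have phic : continuous phi.
  apply: (@lipschitz_fnorm_continuous _ _ _ _ _
    (fnorm Zs * fnorm (skew_exp A s t))) => V W.
  rewrite (le_trans (fnorm_dist _ _))// opprB addrC addrA subrK /X -mulmxBr.
  rewrite -mulrA (le_trans (fnorm_mul _ _))// ler_wpM2l ?fnorm_ge0//.
  rewrite -raddfB fnorm_tr -mulmxBl (le_trans (fnorm_mul _ _))// mulrC.
  by rewrite (fnormBC V).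
have cl : closed [set V | phi V <= Num.sqrt bnd].
  move/continuous_closedP : phic => /(_ _ (closed_le (y := Num.sqrt bnd))).
  exact.
rewrite phi_bnd; move: clU; rewrite clusterE => clU.
suff : closure [set V | phi V <= Num.sqrt bnd] U by move/closure_id : cl => <-.
apply: clU.
exists (Num.truncn (t - T0)).+1 => // n /= tn; rewrite -phi_bnd.
have tT : T0 <= t <= T0 + n%:R.
  by rewrite T0t -lerBlDl (le_trans (ltW (truncnS_gt _)))// ler_nat.
apply: (backward_gronwall (D := fun s => Z s - X (U_ n) s) tT _ etaK).
  move=> u T0u; apply: (is_derive_eq (is_deriveB (dZ u T0u) (dX (U_ n) u))).
  by rewrite mulmxBr addrAC.
exact: (HU n).2.
Qed.

End Phase.

(** * Back to stacked vectors *)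

Section Translation.
Variable R : realType.

Lemma errorE (m q : nat) (zd z : 'cV[R]_(q * m)) :
  error zd z = rdot (unstack z) (unstack z) - rdot (unstack zd) (unstack zd).
Proof.
have blkE2 (x : 'cV[R]_(q * m)) k : enorm (blk x k) ^+ 2 = rdot (unstack x) (unstack x) k 0.
  rewrite enormE fnormsq fdotE mxE; apply: eq_bigr => a _.
  by rewrite big_ord1 !mxE.
by apply/colP => k; rewrite mxE !blkE2 !mxE.
Qed.

Lemma unstack_control (n m q : nat) (G : sensing_graph n q) (zd : 'cV[R]_(q * m)) mu
    (p v : 'cV[R]_(n * m)) :
  unstack (control G zd mu p v) =
  acceleration (incidence R G) (incidence_tail R G) mu (unstack zd)
    ((incidence R G)^T *m unstack p) (unstack v).
Proof.
rewrite /control /acceleration !unstackB unstackN.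
rewrite -!mulmxA !unstack_bar !unstack_blkdiag errorE.
by rewrite /relpos !unstack_barT.
Qed.

Lemma centering (n m : nat) (P : 'M[R]_(n, m)) : (0 < n)%N ->
  exists c : 'rV[R]_m, centered (stack (P - (const_mx 1 : 'cV_n) *m c)).
Proof.
move=> n0; exists (n%:R^-1 *: \sum_i row i P); rewrite /centered.
apply: trmx_inj; rewrite trmx0 raddf_sum/=.
under eq_bigr => i _.
  rewrite blkE stackK trmxK [row _ _]raddfB/= row_mul.
  rewrite (_ : row i (const_mx 1) = 1%:M); last first.
    by apply/matrixP => a b; rewrite !mxE !ord1.
  rewrite mul1mx; over.
rewrite big_split/= sumr_const card_ord -scaler_nat scalerN scalerA mulfV ?scale1r ?subrr//.
by rewrite pnatr_eq0 -lt0n.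
Qed.

Lemma exp_cvg (a b : nat) (X : R -> 'M[R]_(a, b)) (L : 'M[R]_(a, b)) (K g t0 : R) :
  0 < g -> (forall t, t0 <= t -> fnorm (X t - L) <= K * expR (- g * (t - t0))) ->
  X t @[t --> +oo] --> L.
Proof.
move=> g0 XL; apply/cvgrPdist_le => e e0.
have K0 : 0 <= K.
  by have := XL t0 (lexx _); rewrite subrr mulr0 expR0 mulr1; exact: le_trans (fnorm_ge0 _).
exists (t0 + K / (g * e)); split; first exact: num_real.
move=> t tt; rewrite distrC (le_trans (normr_le_fnorm _))//.
have ge0 : 0 < g * e by rewrite mulr_gt0.
have t0t : t0 <= t.
  by rewrite (le_trans _ (ltW tt))// lerDl divr_ge0// ltW.
rewrite (le_trans (XL t t0t))// mulNr expRN ler_pdivrMr ?expR_gt0//.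
have : K <= (t - t0) * (g * e) by rewrite -ler_pdivrMr// lerBrDl ltW.
have := ler_wpM2l (ltW e0) (expR_ge1Dx (g * (t - t0))).
by have := ltW e0; lra.
Qed.

(** The differential equations are only used from a positive time on, where both
    components are differentiable; the initial condition is carried there by
    continuity. *)
Lemma right_close (k : nat) (x y : R -> 'cV[R]_k) (e : R) : 0 < e ->
  {within `[0, +oo[, continuous x} -> {within `[0, +oo[, continuous y} ->
  exists2 t, 0 < t & fnorm (x t - x 0) <= e /\ fnorm (y t - y 0) <= e.
Proof.
move=> e0 xc yc.
pose c : R := Num.sqrt (k * 1)%:R + 1.
have c0 : 0 < c by rewrite ltr_wpDl// sqrtr_ge0.
have ec : 0 < e / c by rewrite divr_gt0.
have close (z : R -> 'cV[R]_k) : {within `[0, +oo[, continuous z} ->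
    \forall t \near (0 : R)^'+, fnorm (z t - z 0) <= e.
  move=> /(continuous_within_itvcyP) [_ zc].
  have /cvgrPdist_le/(_ _ ec) := zc.
  apply: filterS => t; rewrite ler_pdivlMr// distrC => zt.
  apply: (le_trans (fnorm_le_normr _)); apply: le_trans zt.
  by rewrite mulrC ler_wpM2l// lerDl.
have xe := close x xc; have ye := close y yc.
near (0 : R)^'+ => t; exists t; first by [].
by split; near: t.
Unshelve. all: by end_near. Qed.

End Translation.

(** * Rigid motion of the limit shape *)

(** The attitude is the exponential of the constant angular velocity, and the
    origin moves along the integral of the exponential applied to vc. *)
Lemma rigid_motion_solution (R : realType) (n m : nat) (r : 'cV[R]_(n * m))
    (w : 'cV[R]_3) (vc : 'cV[R]_m) (U : 'M[R]_m) (s : R) :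
  let A := cross_mx m w in
  A *m A *m A = - s ^+ 2 *: A -> (s = 0 -> A = 0) -> rotation U ->
  exists ps vs : R -> 'cV[R]_(n * m), rigid_body_motion r w vc ps vs /\
    forall t, let Q := U *m skew_exp A s t in
     (exists c : 'rV[R]_m,
        unstack (ps t) = (const_mx 1 : 'cV_n) *m c + unstack r *m Q^T) /\
     unstack (vs t) = rigid_motion (unstack r) w vc *m Q^T.
Proof.
move=> A cube A0 rU.
pose Q t := U *m skew_exp A s t.
pose c t := U *m (skew_int A s t *m vc).
pose ps t := stack ((const_mx 1 : 'cV[R]_n) *m (c t)^T + unstack r *m (Q t)^T).
pose vs t := stack (rigid_motion (unstack r) w vc *m (Q t)^T).
exists ps, vs; split; last first.
  by move=> t Q'; rewrite /ps /vs !stackK; split=> //; exists (c t)^T.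
exists Q, c => t.
have dQ : is_derive t 1 Q (Q t *m A).
  apply: (is_derive_eq (is_derive_mull U (is_derive_skew_exp cube A0 t))).
  by rewrite mulmxA.
have dc : is_derive t 1 c (Q t *m vc).
  apply: (is_derive_eq (is_derive_mull U (is_derive_mulr vc
    (is_derive_skew_int A0 t)))).
  by rewrite mulmxA.
split=> //.
- by apply: rotationM => //; exact: (skew_exp_rotation (cross_mxT m w) cube A0).
- move=> i; rewrite !blkE /ps stackK raddfD/= raddfD/= !row_mul !trmx_mul !trmxK.
  rewrite (_ : row i (const_mx 1) = 1%:M) ?trmx1 ?mulmx1//.
  by apply/matrixP => a b; rewrite !mxE !ord1.
apply: is_derive_stack.
apply: (is_derive_eq (is_deriveD
  (is_derive_mull (const_mx 1) (is_derive_trmx dc))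
  (is_derive_mull (unstack r) (is_derive_trmx dQ)))).
by rewrite /rigid_motion mulmxDl !trmx_mul !mulmxA.
Qed.

Lemma fnorm_row (R : realType) (n m : nat) (X : 'M[R]_(n, m)) i :
  fnorm (row i X) <= fnorm X.
Proof.
rewrite -(@ler_pXn2r _ 2) ?nnegrE ?fnorm_ge0// !fnormsq !fdotE big_ord1.
rewrite [leRHS](bigD1 i)//= [leLHS](eq_bigr (fun j => X i j * X i j)).
  by rewrite lerDl; do 2![apply: sumr_ge0 => ? _]; rewrite -expr2 sqr_ge0.
by move=> j _; rewrite !mxE.
Qed.

Theorem mainTheorem1 (R : realType) (n m q : nat) (G : sensing_graph n q)
    (pd : 'cV[R]_(n * m)) :
  (2 <= n)%N -> m = 2%N \/ m = 3%N ->
  inf_min_rigid G pd ->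
  forall zd : 'cV[R]_(q * m), zd = relpos G pd ->
  forall eta : R, 0 < eta ->
  exists eps1 eps2 delta : R,
    [/\ 0 < eps1 < eta, 0 < eps2 < eta, 0 < delta &
      forall mu : 'cV[R]_q, enorm mu <= eps1 ->
      exists (es : 'cV[R]_q) (r : 'cV[R]_(n * m))
             (w : 'cV[R]_3) (vc : 'cV[R]_m),
        [/\ enorm es <= eps2,
            inf_min_rigid G r,
            error zd (relpos G r) = es,
            centered r &
            forall p v : R -> 'cV[R]_(n * m),
              solution G zd mu p v ->
              (exists2 z0, desired_shape zd z0 &
                           enorm (relpos G (p 0) - z0) <= delta) ->
              enorm (v 0) <= delta ->
              error zd (relpos G (p t)) @[t --> +oo] --> es /\
              exists ps vs : R -> 'cV[R]_(n * m),
                [/\ rigid_body_motion r w vc ps vs,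
                    relpos G (p t) - relpos G (ps t) @[t --> +oo] -->
                      (0 : 'cV[R]_(q * m)) &
                    forall i : 'I_n,
                      blk (v t) i - blk (vs t) i @[t --> +oo] -->
                        (0 : 'cV[R]_m)]]].
Proof.
move=> n2 m23 rigid zd zdE eta eta0.
have n0 : (0 < n)%N by exact: ltn_trans n2.
pose B := incidence R G; pose S := incidence_tail R G.
pose Zd := B^T *m unstack pd.
have relposE x : unstack (relpos G x) = B^T *m unstack x by rewrite unstack_barT.
have zdZ : unstack zd = Zd by rewrite zdE relposE.
have [rho [k [delta [g [K [rho0 k0 delta0 g0 decay]]]]]] := error_decay S n2 m23 rigid.
have [c [rho_c [c0 rho_c0 coer]]] := stress_coercive rigid.
have [H [Hi [HE HHi]]] := rigidity_gram rigid.
have b0 : 0 <= fnorm B := fnorm_ge0 B.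
have b1 : 0 < fnorm B + 1 by rewrite ltr_wpDl.
have M0 : 0 < fnorm Zd + 1 by rewrite ltr_wpDl ?fnorm_ge0.
have [rho' [rho'0 [rho'r rho'c rho'1] [rho'e rho'k rho'g]]] : exists rho' : R,
   [/\ 0 < rho',
       [/\ fnorm B * rho' <= rho, fnorm B * rho' <= rho_c & fnorm B * rho' <= 1] &
       [/\ 2 * (fnorm Zd + 1) * (fnorm B * rho') <= eta / 2, rho' <= k &
           fnorm B * rho' <= g / 8]].
  have small (x : R) : 0 < x ->
      exists2 y, 0 < y & forall u, 0 <= u -> u <= y -> fnorm B * u <= x.
    move=> x0; exists (x / (fnorm B + 1)) => [|u u0]; first by rewrite divr_gt0.
    rewrite ler_pdivlMr// => ux; apply: le_trans (ux).
    by rewrite mulrC ler_wpM2l// lerDl.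
  have e4 : 0 < eta / 2 / (2 * (fnorm Zd + 1)) by rewrite !divr_gt0// mulr_gt0.
  have g8 : 0 < g / 8 by rewrite divr_gt0.
  have [y1 y10 H1] := small _ rho0; have [y2 y20 H2] := small _ rho_c0.
  have [y3 y30 H3] := small _ (@ltr01 R); have [y4 y40 H4] := small _ e4.
  have [y5 y50 H5] := small _ g8.
  pose u := Num.min k (Num.min y1 (Num.min y2 (Num.min y3 (Num.min y4 y5)))).
  have u0 : 0 < u by rewrite !lt_min k0 y10 y20 y30 y40 y50.
  exists u; split=> //; split.
  - by apply: H1; rewrite ?(ltW u0)// !ge_min lexx !orbT.
  - by apply: H2; rewrite ?(ltW u0)// !ge_min lexx !orbT.
  - by apply: H3; rewrite ?(ltW u0)// !ge_min lexx !orbT.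
  - rewrite mulrC -ler_pdivlMr ?mulr_gt0//.
    by apply: H4; rewrite ?(ltW u0)// !ge_min lexx !orbT.
  - by rewrite ge_min lexx.
  - by apply: H5; rewrite ?(ltW u0)// !ge_min lexx !orbT.
(* the steady motion, with so small a radius that the preceding lemmas apply *)
have [eps eps0 equil] := relative_equilibrium S HE HHi rho'0.
have e20 : 0 < eta / 2 by rewrite divr_gt0.
have e2e : eta / 2 < eta by rewrite gtr_pMr// invf_lt1// ltr1n.
exists (Num.min eps (eta / 2)), (eta / 2), (delta / 2); split.
- by rewrite lt_min eps0 e20/= gt_min e2e orbT.
- by rewrite e20.
- by rewrite divr_gt0.
move=> mu; rewrite enormE le_min => /andP[mueps _].
have [Ps [C [PsP CC quad flow]]] := equil mu mueps.
set Zs := B^T *m Ps in quad flow.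
have ZsZd : fnorm (Zs - Zd) <= fnorm B * rho'.
  rewrite /Zs /Zd -mulmxBr (le_trans (fnorm_mul _ _))// fnorm_tr ler_wpM2l//.
have [c1 cent] := centering Ps n0.
set r := stack _ in cent.
have rZs : B^T *m unstack r = Zs.
  by rewrite stackK mulmxBr mulmxA incidenceT_const mul0mx subr0.
pose es := rdot Zs Zs - rdot Zd Zd.
have r_rigid : inf_min_rigid G r.
  apply: stress_free_rigid; first by case: rigid.
  move=> e; rewrite -/B rZs => e0.
  have := coer Zs (le_trans ZsZd rho'c) e; rewrite -/B e0 fnorm0 pmulr_rle0//.
  by move=> en; apply: fnorm_eq0; apply/eqP; rewrite eq_le en fnorm_ge0.
have [w [vc CZ]] : exists w vc, C *m Zs = rigid_motion (unstack r) w vc.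
  have [|q0|//] := ker_rigidity n2 m23 r_rigid (X := C *m Zs).
    by rewrite -/B rZs.
  exists 0, 0; rewrite /rigid_motion (linear0 (@cross_mx R m)) !trmx0 !mulmx0 addr0.
  apply/matrixP => i j; rewrite !mxE big1// => l _; exfalso.
  by case: l => l; rewrite q0.
exists es, r, w, vc; split=> //.
- rewrite enormE /es -/(err Zd Zs).
  rewrite (le_trans (err_near (M := fnorm Zd + 1) (rotation1 R m) _ _))//.
  + have := fnormD (Zs - Zd) Zd; rewrite subrK => /le_trans; apply.
    by rewrite addrC lerD2l (le_trans ZsZd).
  + by rewrite lerDl.
  + rewrite trmx1 mulmx1; apply: le_trans rho'e; rewrite ler_wpM2l//.
    by rewrite mulr_ge0// ltW.
- by rewrite errorE relposE rZs zdZ.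
move=> p v [pc vcont dp dv] [_ [Q0 rQ0 <-]].
rewrite !enormE -fnorm_unstack unstackB relposE unstack_rot zdZ => Zp0.
rewrite -fnorm_unstack => Vp0.
pose P t := unstack (p t); pose V t := unstack (v t); pose Z t := B^T *m P t.
have d4 : 0 < delta / 2 / (fnorm B + 1) by rewrite !divr_gt0.
have [t0 t00 [pt0 vt0]] := right_close d4 pc vcont.
have dP t : t0 <= t -> is_derive t 1 P (V t).
  by move=> tt0; apply: is_derive_unstack; apply: dp; exact: lt_le_trans tt0.
have dV t : t0 <= t -> is_derive t 1 V (acceleration B S mu Zd (Z t) (V t)).
  move=> tt0; rewrite -zdZ -unstack_control; apply: is_derive_unstack.
  by apply: dv; exact: lt_le_trans tt0.
have stat : stationary B S C mu Zs Zd by [].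
have Z0 : exists2 Q, rotation Q & fnorm (Z t0 - Zd *m Q^T) <= delta.
  exists Q0 => //.
  have -> : Z t0 - Zd *m Q0^T = B^T *m unstack (p t0 - p 0) +
      (B^T *m unstack (p 0) - Zd *m Q0^T).
    by rewrite unstackB mulmxBr addrA subrK.
  rewrite (splitr delta) (le_trans (fnormD _ _))// lerD//.
  rewrite (le_trans (fnorm_mul _ _))// fnorm_tr fnorm_unstack.
  rewrite (le_trans (ler_wpM2l b0 pt0))// mulrCA ger_pMr ?divr_gt0//.
  by rewrite ler_pdivrMr// mul1r lerDl.
have V0 : fnorm (V t0) <= delta.
  have -> : V t0 = unstack (v t0 - v 0) + unstack (v 0) by rewrite unstackB subrK.
  rewrite (splitr delta) (le_trans (fnormD _ _))// lerD// fnorm_unstack.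
  rewrite (le_trans vt0)// ler_pdivrMr// ler_pMr ?divr_gt0//.
  by rewrite lerDr.
have := decay C mu Ps (le_trans ZsZd rho'r) (le_trans CC rho'k) stat P V t0 dP dV Z0 V0.
rewrite -/Zs -/(Z _) => {}decay.
have K0 : 0 <= K.
  have [+ _ _] := decay t0 (lexx _); rewrite subrr mulr0 expR0 mulr1.
  exact: le_trans (fnorm_ge0 _).
split.
  apply: (@exp_cvg _ _ _ _ _ K g t0) => // t tt0.
  have [Et _ _] := decay t tt0.
  by rewrite errorE relposE zdZ /es opprB addrA subrK.
have [s cube A0] := cross_mx_cube w m23.
pose K' := K * (fnorm B + 1).
have K'0 : 0 <= K' by rewrite mulr_ge0// ltW.
have KK' : K <= K' by rewrite /K' ler_peMr// lerDr.
have Fg : fnorm (B^T *m C) <= g / 8.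
  rewrite (le_trans (fnorm_mul _ _))// fnorm_tr (le_trans _ rho'g)//.
  by rewrite ler_wpM2l.
have FZs : B^T *m C *m Zs = Zs *m (cross_mx m w)^T.
  by rewrite -mulmxA CZ incidenceT_rigid_motion -/B rZs.
have dZ t : t0 <= t -> is_derive t 1 Z (B^T *m C *m Z t + B^T *m (V t - C *m Z t)).
  move=> tt0; apply: (is_derive_eq (is_derive_mull B^T (dP t tt0))).
  by rewrite mulmxBr -[X in X + _]mulmxA addrCA subrr addr0.
have etaK t : t0 <= t -> fnorm (B^T *m (V t - C *m Z t)) <= K' * expR (- g * (t - t0)).
  move=> tt0; have [_ Yt _] := decay t tt0.
  rewrite (le_trans (fnorm_mul _ _))// fnorm_tr (le_trans (ler_wpM2l b0 Yt))//.
  by rewrite mulrA ler_wpM2r ?expR_ge0// mulrC /K' ler_wpM2l// lerDl.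
have nearZ t : t0 <= t -> exists2 Q, rotation Q &
    fnorm (Z t - Zs *m Q^T) <= K' * expR (- g * (t - t0)).
  move=> tt0; have [_ _ [Q rQ ZQ]] := decay t tt0; exists Q => //.
  by rewrite (le_trans ZQ)// ler_wpM2r ?expR_ge0.
have [U rU phase] := asymptotic_phase g0 K'0 Fg (cross_mxT m w) cube A0 FZs dZ etaK nearZ.
set K2 := K' ^+ 2 + _ in phase.
have [ps [vs [motion psE]]] := @rigid_motion_solution R n m r w vc U s cube A0 rU.
have K20 : 0 <= K2.
  rewrite /K2 addr_ge0 ?sqr_ge0// divr_ge0 ?sqr_ge0//.
  by rewrite mulr_ge0// sqr_ge0.
have close t : t0 <= t -> fnorm (Z t - Zs *m (U *m skew_exp (cross_mx m w) s t)^T) <=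
    Num.sqrt K2 * expR (- (g / 4) * (t - t0)).
  move=> tt0.
  rewrite -(@ler_pXn2r _ 2) ?nnegrE ?fnorm_ge0 ?mulr_ge0 ?sqrtr_ge0 ?expR_ge0//.
  rewrite fnormsq (le_trans (phase t tt0))// exprMn sqr_sqrtr// -expRM_natl.
  by rewrite (_ : 2%:R * (- (g / 4) * (t - t0)) = - (g / 2) * (t - t0))//; field.
have g4 : 0 < g / 4 by rewrite divr_gt0.
exists ps, vs; split=> //.
- apply: (exp_cvg g4 (K := Num.sqrt K2) (t0 := t0)) => t tt0.
  have [[c2 psc] _] := psE t.
  rewrite subr0 -fnorm_unstack unstackB !relposE psc.
  rewrite [B^T *m (_ + _)]mulmxDr mulmxA incidenceT_const mul0mx add0r mulmxA rZs.
  exact: close.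
- move=> i; apply: (exp_cvg g4 (K := K + fnorm C * Num.sqrt K2) (t0 := t0)) => t tt0.
  have [_ vsE] := psE t.
  rewrite subr0 !blkE -!raddfB fnorm_tr (le_trans (fnorm_row _ _))//.
  rewrite vsE -CZ -/(V t); set Q := U *m _.
  have -> : V t - C *m Zs *m Q^T = (V t - C *m Z t) + C *m (Z t - Zs *m Q^T).
    by rewrite mulmxBr (mulmxA C Zs) addrA subrK.
  rewrite (le_trans (fnormD _ _))// mulrDl lerD//.
    have [_ Yt _] := decay t tt0; rewrite (le_trans Yt)// ler_wpM2l// ler_expR.
    have : 0 <= g * (t - t0) by rewrite mulr_ge0 ?(ltW g0)// subr_ge0.
    by rewrite !mulNr lerN2; lra.
  by rewrite (le_trans (fnorm_mul _ _))// -mulrA ler_wpM2l ?fnorm_ge0// close.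
Qed.
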